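(* $$K(M_{n,\lfloor n/2\rfloor},F_{\mathrm{nb}},G_{\mathrm{nb}})\,[\![(\forall X)(\forall Y)(\forall m)(\exists x)\,\varphi_{\mathrm{RetractionWeakPigeon}}(X,Y,m,x)]\!]=\mathbf 1,$$ where $\varphi_{\mathrm{RetractionWeakPigeon}}(X,Y,m,x)$ is the formula $$(m=0)\vee\big(|x|<|m|\wedge\big[(|X(x)|\ge|m|-1)\vee(Y(X(x))\ne x)\big]\big).$$
   Context: Setup. $L_{all}$ is the first-order language with a name for every relation and function on $\mathbb N$. Fix an $\aleph_1$-saturated nonstandard model $\mathcal M$ of the true theory $\mathrm{Th}_{L_{all}}(\mathbb N)$, with $\mathbb N\subseteq\mathcal M$ as an initial segment, and a nonstandard number $n\in\mathcal M\setminus\mathbb N$ which is a power of two. Finite sets, functions, sequences and trees are coded by numbers; for a coded set $S$, $|S|\in\mathcal M$ is its cardinality, while for a number $m$ (in particular in the formula of the claim) $|m|$ is its bit length. Any sequence of standard finite objects has a value at index $n$ in $\mathcal M$ (via the corresponding function symbol of $L_{all}$). $\mathrm{st}$ is the standard part of finite $\mathcal M$-rationals; an $\mathcal M$-rational $q$ is infinitesimal if $|q|<1/k$ for all standard $k\ge1$. $\mathcal M_n\subseteq\mathcal M$ is the set of numbers bounded above by $2^{n^{1/t}}$ for some $t\in\mathcal M\setminus\mathbb N$. $L_n\subseteq L_{all}$ consists of all relation symbols and all function symbols whose values on tuples from $\mathcal M_n$ lie in $\mathcal M_n$; $\mathcal M_n$ is regarded as an $L_n$-structure. The language $L_n^2$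 extends $L_n$ (number sort) by set-sort variables $X,Y,\dots$ standing for functions of finite arity on the number sort, which can be applied to number terms to form number terms, and by equality for the set sort. An expression $X(\overline x)$ used as a formula abbreviates $X(\overline x)\ne0$. $\langle i,j\rangle$ is a pairing function on $\mathcal M_n$. Sample space. $M_{k,\lfloor k/2\rfloor}$ is the set of all $\{E\}$-structures on $\{0,\dots,k-1\}$ in which $E$ is the graph of a function from $\{0,\dots,k-1\}$ to $\{0,\dots,\lfloor k/2\rfloor-1\}$; $M_{n,\lfloor n/2\rfloor}$ is its value at index $n$. For $\omega\in M_{n,\lfloor n/2\rfloor}$ the neighbor of $i<n$ in $\omega$ is the image of $i$ under the function whose graph is $\omega$. Boolean algebra. $\mathcal A$ is the algebra of subsets of $M_{n,\lfloor n/2\rfloor}$ coded in $\mathcal M$, $\mathcal I$ the ideal of those $A$ with $|A|/|M_{n,\lfloor n/2\rfloor}|$ infinitesimal, and $\mathcal B=\mathcal A/\mathcal I$, a complete Boolean algebra with least element $\mathbf 0$, greatest element $\mathbf 1$ and measure $\mu(A/\mathcal I)=\mathrm{st}(|A|/|M_{n,\lfloor n/2\rfloor}|)$. Trees. $\mathcal T_{\mathrm{nb}}$ is the set of all labeled rooted trees coded in $\mathcal M$ such that: each non-leaf node is labeled by some $v\in\{0,\dots,n-1\}$ and has for each $u\in\{0,\dots,n-1\}$ an outgoing edge labeled $u$; each leaf is labeled by an element of $\mathcal M_n$; the depth is at most $n^{1/t}$ (rounded) for some $t\in\mathcal M\setminus\mathbb N$. The computation of $T$ on $\omega$ starts at the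 root and at a node labeled $v$ follows the edge labeled by the neighbor of $v$ in $\omega$ until a leaf is reached; its label is $T(\omega)$. $F_{\mathrm{nb}}$ is the set of all functions on $M_{n,\lfloor n/2\rfloor}$ computed by trees in $\mathcal T_{\mathrm{nb}}$. Random functions. A $k$-ary random function $\Theta$ assigns to each $\omega$ a $k$-ary function $\Theta_\omega$ coded in $\mathcal M$ with arguments from a domain of $k$-tuples from $\mathcal M_n$ and values in $\mathcal M_n$; for $\alpha_0,\dots,\alpha_{k-1}\in F_{\mathrm{nb}}$, $\Theta(\alpha_0,\dots,\alpha_{k-1})$ is the function $\omega\mapsto\Theta_\omega(\alpha_0(\omega),\dots,\alpha_{k-1}(\omega))$, with value $0$ when the arguments are outside the domain. $G_{\mathrm{nb}}$ is the family of all random functions on $M_{n,\lfloor n/2\rfloor}$ such that: for each unary $\Theta\in G_{\mathrm{nb}}$ there is a tuple $(\gamma_0,\dots,\gamma_{m-1})$, $m\in\mathcal M_n$, coded by an element of $\mathcal M$, with all $\gamma_i\in F_{\mathrm{nb}}$ and, for all $\alpha\in F_{\mathrm{nb}}$, $\Theta(\alpha)(\omega)=\gamma_{\alpha(\omega)}(\omega)$ if $\alpha(\omega)<m$ and $0$ otherwise; for each $k$-ary $\Theta\in G_{\mathrm{nb}}$, $k>1$, there is a $(k-1)$-ary $\Theta'\in G_{\mathrm{nb}}$ with $\Theta(\alpha_0,\dots,\alpha_{k-1})=\Theta'(\alpha_0,\dots,\alpha_{k-3},\langle\alpha_{k-2},\alpha_{k-1}\rangle)$ for all $\alpha_i\in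 F_{\mathrm{nb}}$. The structure $K=K(M_{n,\lfloor n/2\rfloor},F_{\mathrm{nb}},G_{\mathrm{nb}})$ is the $\mathcal B$-valued $L_n^2$-structure with number sort $F_{\mathrm{nb}}$ and set sort $G_{\mathrm{nb}}$ (function symbols of $L_n$ act pointwise in $\omega$, a $k$-ary $\Theta\in G_{\mathrm{nb}}$ sends $\alpha_0,\dots,\alpha_{k-1}\in F_{\mathrm{nb}}$ to the function $\omega\mapsto\Theta_\omega(\alpha_0(\omega),\dots,\alpha_{k-1}(\omega))$, with value $0$ at those $\omega$ where the arguments are outside the domain of $\Theta_\omega$, so terms evaluate to elements of $F_{\mathrm{nb}}$) and truth values: $[\![\alpha=\beta]\!]=\{\omega:\alpha(\omega)=\beta(\omega)\}/\mathcal I$; $[\![R(\alpha_0,\dots,\alpha_{k-1})]\!]=\{\omega:\mathcal M_n\models R(\alpha_0(\omega),\dots,\alpha_{k-1}(\omega))\}/\mathcal I$ for relation symbols $R\in L_n$; $[\![\Theta=\Xi]\!]=\{\omega:\Theta_\omega=\Xi_\omega\}/\mathcal I$; $[\![-]\!]$ commutes with $\neg,\wedge,\vee$; $\forall x,\exists x$ are interpreted by $\bigwedge_{\alpha\in F_{\mathrm{nb}}},\bigvee_{\alpha\in F_{\mathrm{nb}}}$ and $\forall X,\exists X$ by $\bigwedge_{\Theta\in G_{\mathrm{nb}}},\bigvee_{\Theta\in G_{\mathrm{nb}}}$ (over $\Theta$ of the appropriate arity; here $X,Y$ are unary). *)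

(* Defs.v *)
From mathcomp Require Import all_boot all_order all_algebra finmap.
From mathcomp Require Import boolp classical_sets.

Set Implicit Arguments.
Unset Strict Implicit.
Unset Printing Implicit Defensive.

Local Open Scope nat_scope.
Local Open Scope fset_scope.
Local Open Scope fmap_scope.
Local Open Scope classical_set_scope.

(** * First-order logic *)

(* k-tuples over [A] are functions ['I_k -> A]. *)
Definition vcons A k (x : A) (v : 'I_k -> A) : 'I_k.+1 -> A :=
  fun i => if unlift ord0 i is Some j then v j else x.
Definition vhd A k (v : 'I_k.+1 -> A) : A := v ord0.
Definition vtl A k (v : 'I_k.+1 -> A) : 'I_k -> A := fun i => v (lift ord0 i).

Record language := Language { fsym : nat -> Type; rsym : nat -> Type }.

Record structure (L : language) := Structure {
  carrier :> Type;
  fint : forall k, fsym L k -> ('I_k -> carrier) -> carrier;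
  rint : forall k, rsym L k -> ('I_k -> carrier) -> Prop }.
Arguments fint {L} s {k}.
Arguments rint {L} s {k}.

(* De Bruijn syntax: [term L n] and [formula L n] have their free variables
   in ['I_n]; the innermost binder binds variable 0. *)
Inductive term (L : language) (n : nat) : Type :=
| Var of 'I_n
| Fun k of fsym L k & ('I_k -> term L n).

Inductive formula (L : language) : nat -> Type :=
| FEq n of term L n & term L n : formula L n
| FRel n k of rsym L k & ('I_k -> term L n) : formula L n
| FNot n of formula L n : formula L n
| FAnd n of formula L n & formula L n : formula L n
| FOr n of formula L n & formula L n : formula L n
| FAll n of formula L n.+1 : formula L n
| FEx n of formula L n.+1 : formula L n.

Fixpoint teval L (M : structure L) n (e : 'I_n -> M) (t : term L n) : M :=
  match t with
  | Var i => e i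
  | Fun k f ts => fint M f (fun i => teval e (ts i))
  end.

Fixpoint sat L (M : structure L) n (phi : formula L n) : ('I_n -> M) -> Prop :=
  match phi with
  | FEq _ t u => fun e => teval e t = teval e u
  | FRel _ _ R ts => fun e => rint M R (fun i => teval e (ts i))
  | FNot _ p => fun e => ~ sat p e
  | FAnd _ p q => fun e => sat p e /\ sat q e
  | FOr _ p q => fun e => sat p e \/ sat q e
  | FAll _ p => fun e => forall a : M, sat p (vcons a e)
  | FEx _ p => fun e => exists a : M, sat p (vcons a e)
  end.

Definition models L (M : structure L) (phi : formula L 0) : Prop :=
  forall e : 'I_0 -> M, sat phi e.

(* Every countable family of formulas in one variable, with parameters, which
   is finitely satisfiable is satisfiable. *)
Definition aleph1_saturated L (M : structure L) : Prop :=
  forall (k : nat -> nat) (phi : forall j, formula L (k j).+1)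
         (e : forall j, 'I_(k j) -> M),
  (forall l, exists a : M, forall j, j < l -> sat (phi j) (vcons a (e j))) ->
  exists a : M, forall j, sat (phi j) (vcons a (e j)).

(** * The language of all relations and functions on the natural numbers *)

Definition L_all : language :=
  Language (fun k => ('I_k -> nat) -> nat) (fun k => ('I_k -> nat) -> Prop).

Definition natS : structure L_all :=
  @Structure L_all nat (fun _ f => f) (fun _ R => R).

Definition models_Th (M : structure L_all) : Prop :=
  forall phi : formula L_all 0, models natS phi -> models M phi.

Definition fn0 (c : nat) : fsym L_all 0 := fun _ => c.
Definition fn1 (f : nat -> nat) : fsym L_all 1 := fun v => f (vhd v).
Definition fn2 (f : nat -> nat -> nat) : fsym L_all 2 :=
  fun v => f (vhd v) (vhd (vtl v)).
Definition fn3 (f : nat -> nat -> nat -> nat) : fsym L_all 3 :=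
  fun v => f (vhd v) (vhd (vtl v)) (vhd (vtl (vtl v))).
Definition rl1 (R : nat -> Prop) : rsym L_all 1 := fun v => R (vhd v).
Definition rl2 (R : nat -> nat -> Prop) : rsym L_all 2 :=
  fun v => R (vhd v) (vhd (vtl v)).
Definition rl3 (R : nat -> nat -> nat -> Prop) : rsym L_all 3 :=
  fun v => R (vhd v) (vhd (vtl v)) (vhd (vtl (vtl v))).

Definition vec0 A : 'I_0 -> A := tnth (nil_tuple A).
Definition vec1 A (x : A) : 'I_1 -> A := vcons x (vec0 A).
Definition vec2 A (x y : A) : 'I_2 -> A := vcons x (vec1 y).
Definition vec3 A (x y z : A) : 'I_3 -> A := vcons x (vec2 y z).

(* The interpretation in [M] of a standard number, function or relation. *)
Section Star.
Variable M : structure L_all.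
Definition star0 c : M := fint M (fn0 c) (vec0 M).
Definition star1 f (x : M) : M := fint M (fn1 f) (vec1 x).
Definition star2 f (x y : M) : M := fint M (fn2 f) (vec2 x y).
Definition star3 f (x y z : M) : M := fint M (fn3 f) (vec3 x y z).
Definition starR1 R (x : M) : Prop := rint M (rl1 R) (vec1 x).
Definition starR2 R (x y : M) : Prop := rint M (rl2 R) (vec2 x y).
Definition starR3 R (x y z : M) : Prop := rint M (rl3 R) (vec3 x y z).
End Star.
Arguments star0 {M}.
Arguments star1 {M}.
Arguments star2 {M}.
Arguments star3 {M}.
Arguments starR1 {M}.
Arguments starR2 {M}.
Arguments starR3 {M}.

(** * Standard finite objects and their codes *)

(* An object of a countable type [T] is coded by its [choice.pickle]. *)
Definition is_code (T : countType) (c : nat) : Prop := exists x : T, choice.pickle x = c.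
Definition decode (T : countType) (x0 : T) (c : nat) : T := odflt x0 (choice.unpickle c).

Definition bitlen (m : nat) : nat := up_log 2 m.+1.
Definition exp2 (m : nat) : nat := 2 ^ m.
(* [k^(1/t)] rounded down, for [t > 0]. *)
Definition iroot (t k : nat) : nat := \max_(r < k.+1 | r ^ t <= k) r.
Definition pairing (i j : nat) : nat := 'C((i + j).+1, 2) + j.

Definition set_mem (x s : nat) : Prop :=
  x \in decode (fset0 : {fset nat}) s.
Definition set_card (s : nat) : nat := #|` decode (fset0 : {fset nat}) s|.

(* The ratio [a / b] is smaller than [1 / k]. *)
Definition ratio_lt (k a b : nat) : Prop :=
  (a%:R / b%:R < k%:R^-1 :> rat)%R.

(* The interpretation of [E] in a structure on {0, ..., k-1} is coded as a
   finite set of pairs. *)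
Definition graph k l (f : {ffun 'I_k -> 'I_l}) : {fset nat * nat} :=
  [fset (val i, val (f i)) | i in 'I_k].
Definition sample_space (k : nat) : {fset nat} :=
  [fset choice.pickle (graph f) | f in {ffun 'I_k -> 'I_(k./2)}].
Definition in_sample_space (k w : nat) : Prop := w \in sample_space k.
Definition card_sample_space (k : nat) : nat := #|` sample_space k|.
Definition neighbor (w i : nat) : nat :=
  head 0 [seq e.2 | e <- decode (fset0 : {fset nat * nat}) w & e.1 == i].

(* [GenTree.Node v [:: T_0; ...; T_(k-1)]] is a non-leaf node labeled [v] whose
   outgoing edge labeled [u] leads to [T_u]. *)
Notation ltree := (GenTree.tree nat).
Fixpoint depth (T : ltree) : nat :=
  if T is GenTree.Node _ s then (foldr maxn 0 [seq depth t | t <- s]).+1 else 0.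
Fixpoint wf_tree (k : nat) (T : ltree) : bool :=
  if T is GenTree.Node v s then [&& v < k, size s == k & all (wf_tree k) s]
  else true.
Fixpoint leaves (T : ltree) : seq nat :=
  match T with
  | GenTree.Leaf x => [:: x]
  | GenTree.Node _ s => flatten [seq leaves t | t <- s]
  end.
Fixpoint run (w : nat) (T : ltree) : nat :=
  match T with
  | GenTree.Leaf x => x
  | GenTree.Node v s => nth 0 [seq run w t | t <- s] (neighbor w v)
  end.

Definition decode_tree : nat -> ltree := decode (GenTree.Leaf 0).
Definition is_tree (k d c : nat) : Prop :=
  is_code ltree c /\ wf_tree k (decode_tree c) /\ depth (decode_tree c) <= d.
Definition leaf_label (c x : nat) : Prop := x \in leaves (decode_tree c).
Definition compute (c w : nat) : nat := run w (decode_tree c).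

(* Tuples of unary finite partial functions. *)
Definition decode_ftuple : nat -> seq {fmap nat -> nat} := decode [::].
Definition is_ftuple (m c : nat) : Prop :=
  is_code (seq {fmap nat -> nat}) c /\ size (decode_ftuple c) = m.
Definition ftuple_app (c i w : nat) : nat :=
  odflt 0 (nth [fmap] (decode_ftuple c) i).[? w].

(* Finite partial functions of arity [k]; they get value 0 outside their
   domain. The first argument of [fun_dom] and [fun_app] is the code. *)
Definition is_fun (k c : nat) : Prop := is_code {fmap k.-tuple nat -> nat} c.
Definition decode_fun k : nat -> {fmap k.-tuple nat -> nat} := decode [fmap].
Definition fun_dom k : rsym L_all k.+1 := fun v =>
  [tuple vtl v i | i < k] \in domf (decode_fun k (vhd v)).
Definition fun_app k : fsym L_all k.+1 := fun v =>
  odflt 0 (decode_fun k (vhd v)).[? [tuple vtl v i | i < k]].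

(** * The cut M_n and the language L_n *)

Section Cut.
Variables (M : structure L_all) (n : M).

Definition nonstandard (a : M) : Prop := forall c : nat, a <> star0 c.

Definition power_of_two (a : M) : Prop := exists j : M, a = star1 exp2 j.

(* Since [t] ranges over all nonstandard numbers, the rounding in [iroot]
   affects neither this cut nor the class [T_nb] below. *)
Definition Mn (x : M) : Prop :=
  exists2 t : M, nonstandard t &
    starR2 leq x (star1 exp2 (star2 iroot t n)).

Definition L_n : language :=
  Language
    (fun k => {f : fsym L_all k |
                forall v : 'I_k -> M, (forall i, Mn (v i)) -> Mn (fint M f v)})
    (rsym L_all).

End Cut.

(** * Two-sorted formulas *)

(* [n] is the number of free number variables; [s] lists the free set
   variables, the entry [j] standing for a variable of arity [j.+1]. *)
Section TwoSorted.
Variable L : language.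

Definition ar (s : seq nat) (X : 'I_(size s)) : nat := (nth 0 s X).+1.

Inductive term2 (n : nat) (s : seq nat) : Type :=
| Var2 of 'I_n
| Fun2 k of fsym L k & ('I_k -> term2 n s)
| App2 (X : 'I_(size s)) of ('I_(ar X) -> term2 n s).

Inductive formula2 : nat -> seq nat -> Type :=
| Eq2 n s of term2 n s & term2 n s : formula2 n s
| Rel2 n s k of rsym L k & ('I_k -> term2 n s) : formula2 n s
| SetEq2 n s (X Y : 'I_(size s)) of ar X = ar Y : formula2 n s
| Not2 n s of formula2 n s : formula2 n s
| And2 n s of formula2 n s & formula2 n s : formula2 n s
| Or2 n s of formula2 n s & formula2 n s : formula2 n s
| All2 n s of formula2 n.+1 s : formula2 n s
| Ex2 n s of formula2 n.+1 s : formula2 n s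
| AllSet2 n s j of formula2 n (j :: s) : formula2 n s
| ExSet2 n s j of formula2 n (j :: s) : formula2 n s.

End TwoSorted.
Arguments Var2 {L n s}.

(** * The Boolean-valued structure K *)

Section K.
Variables (M : structure L_all) (n : M).

Definition Omega : Type := {w : M | starR2 in_sample_space n w}.

(** ** The Boolean algebra *)

Definition set_code (c : M) (A : set Omega) : Prop :=
  forall x : M, starR2 set_mem x c <-> exists2 w : Omega, A w & x = sval w.

Definition coded : set (set Omega) := [set A | exists c, set_code c A].

Definition negligible : set (set Omega) := [set A | exists2 c, set_code c A &
  forall k, 0 < k ->
    starR2 (ratio_lt k) (star1 set_card c) (star1 card_sample_space n)].

(* An element of the quotient is an equivalence class, i.e. a set of sets;
   [cls A] is empty, hence not in [BA], if [A] is not coded. *)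
Definition cls (A : set Omega) : set (set Omega) :=
  [set B | coded B /\ negligible (A `+` B)].

Definition BA : set (set (set Omega)) := [set cls A | A in coded].

Definition B1 : set (set Omega) := cls setT.
Definition Bneg (b : set (set Omega)) : set (set Omega) :=
  \bigcup_(P in b) cls (~` P).
Definition Band (b c : set (set Omega)) : set (set Omega) :=
  \bigcup_(P in b) \bigcup_(Q in c) cls (P `&` Q).
Definition Bor (b c : set (set Omega)) : set (set Omega) :=
  \bigcup_(P in b) \bigcup_(Q in c) cls (P `|` Q).
Definition Ble (b c : set (set Omega)) : Prop :=
  exists P Q, [/\ b P, c Q & negligible (P `\` Q)].

Definition is_glb (S : set (set (set Omega))) (b : set (set Omega)) : Prop :=
  (forall c, S c -> Ble b c) /\
  (forall b', BA b' -> (forall c, S c -> Ble b' c) -> Ble b' b).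
Definition is_lub (S : set (set (set Omega))) (b : set (set Omega)) : Prop :=
  (forall c, S c -> Ble c b) /\
  (forall b', BA b' -> (forall c, S c -> Ble c b') -> Ble b b').

(* The glb (lub) of [S] in [BA], as the set of its representatives; it is empty,
   hence not in [BA], if [S] has no glb (lub). *)
Definition Binf (S : set (set (set Omega))) : set (set Omega) :=
  [set P | coded P /\ is_glb S (cls P)].
Definition Bsup (S : set (set (set Omega))) : set (set Omega) :=
  [set P | coded P /\ is_lub S (cls P)].

(** ** The sorts *)

Definition T_nb (T : M) : Prop :=
  (exists2 t : M, nonstandard t & starR3 is_tree n (star2 iroot t n) T) /\
  (forall x : M, starR2 leaf_label T x -> Mn n x).

Definition F_nb : set (Omega -> M) := [set alpha | exists2 T : M, T_nb T &
  forall w, alpha w = star2 compute T (sval w)].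

(* [Theta w] is the code of the function assigned to [w]. *)
Definition random_function (k : nat) : set (Omega -> M) := [set Theta |
  forall w, starR1 (is_fun k) (Theta w) /\
    forall v : 'I_k -> M, rint M (@fun_dom k) (vcons (Theta w) v) ->
      (forall i, Mn n (v i)) /\ Mn n (fint M (@fun_app k) (vcons (Theta w) v))].

Definition rapp k (Theta : Omega -> M) (alpha : 'I_k -> Omega -> M) : Omega -> M :=
  fun w => fint M (@fun_app k) (vcons (Theta w) (fun i => alpha i w)).

(* (alpha_0, ..., alpha_(k-1)) |-> (alpha_0, ..., <alpha_(k-2), alpha_(k-1)>)
   where k = j + 2. *)
Definition merge_last j (alpha : 'I_j.+2 -> Omega -> M) : 'I_j.+1 -> Omega -> M :=
  fun i w => if i == ord_max
    then star2 pairing (alpha (inord j) w) (alpha ord_max w)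
    else alpha (widen_ord (leqnSn j.+1) i) w.

(* [G_nb j] consists of the members of arity [j.+1]. *)
Fixpoint G_nb (j : nat) : set (Omega -> M) :=
  match j with
  | 0 => [set Theta | random_function 1 Theta /\
      exists m g : M,
      [/\ Mn n m,
          starR2 is_ftuple m g,
          (forall i : M, starR2 (fun a b => a < b) i m ->
             F_nb (fun w => star3 ftuple_app g i (sval w))) &
          forall alpha, F_nb alpha -> forall w,
            (starR2 (fun a b => a < b) (alpha w) m ->
               rapp Theta (vec1 alpha) w = star3 ftuple_app g (alpha w) (sval w)) /\
            (~ starR2 (fun a b => a < b) (alpha w) m ->
               rapp Theta (vec1 alpha) w = star0 0)]]
  | j'.+1 => [set Theta | random_function j'.+2 Theta /\
      exists2 Theta', G_nb j' Theta' &
        forall alpha : 'I_j'.+2 -> Omega -> M, (forall i, F_nb (alpha i)) ->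
          rapp Theta alpha = rapp Theta' (merge_last alpha)]
  end.

(** ** Truth values *)

Fixpoint Kterm k s (e : 'I_k -> Omega -> M) (E : 'I_(size s) -> Omega -> M)
    (t : term2 (L_n n) k s) : Omega -> M :=
  match t with
  | Var2 i => e i
  | Fun2 _ f ts => fun w => fint M (sval f) (fun i => Kterm e E (ts i) w)
  | App2 X ts => rapp (E X) (fun i => Kterm e E (ts i))
  end.

Fixpoint Kval k s (phi : formula2 (L_n n) k s) :
    ('I_k -> Omega -> M) -> ('I_(size s) -> Omega -> M) -> set (set Omega) :=
  match phi with
  | Eq2 _ _ t u => fun e E => cls [set w | Kterm e E t w = Kterm e E u w]
  | Rel2 _ _ _ R ts => fun e E => cls [set w | rint M R (fun i => Kterm e E (ts i) w)]
  | SetEq2 _ _ X Y _ => fun e E => cls [set w | E X w = E Y w]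
  | Not2 _ _ p => fun e E => Bneg (Kval p e E)
  | And2 _ _ p q => fun e E => Band (Kval p e E) (Kval q e E)
  | Or2 _ _ p q => fun e E => Bor (Kval p e E) (Kval q e E)
  | All2 _ _ p => fun e E => Binf [set Kval p (vcons a e) E | a in F_nb]
  | Ex2 _ _ p => fun e E => Bsup [set Kval p (vcons a e) E | a in F_nb]
  | AllSet2 _ _ j p => fun e E => Binf [set Kval p e (vcons X E) | X in G_nb j]
  | ExSet2 _ _ j p => fun e E => Bsup [set Kval p e (vcons X E) | X in G_nb j]
  end.

Definition Ksentence (phi : formula2 (L_n n) 0 [::]) : set (set Omega) :=
  Kval phi (vec0 _) (vec0 _).

End K.

(** * Symbols of L_n *)

Section Transfer.
Variables (M : structure L_all) (HM : models_Th M).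

Fixpoint close (k : nat) : formula L_all k -> formula L_all 0 :=
  if k is k'.+1 then fun phi => close (FAll phi) else id.

Lemma vcons_hd_tl A k (v : 'I_k.+1 -> A) : vcons (vhd v) (vtl v) = v.
Proof. by apply: funext => i; rewrite /vcons; case: unliftP => [j|] ->. Qed.

Lemma models_close (N : structure L_all) k (phi : formula L_all k) :
  models N (close phi) <-> forall e, sat (M := N) phi e.
Proof.
elim: k phi => [|k IH] phi //=; rewrite IH /=; split=> H e => [|a] //.
by rewrite -(vcons_hd_tl e).
Qed.

Lemma transfer k (phi : formula L_all k) :
  (forall e, sat (M := natS) phi e) -> forall e, sat (M := M) phi e.
Proof. by move=> /models_close/HM/models_close. Qed.

Lemma map_vcons A B (h : A -> B) k (x : A) (v : 'I_k -> A) :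
  (fun i => h (vcons x v i)) = vcons (h x) (fun i => h (v i)).
Proof. by apply: funext => i; rewrite /vcons; case: unliftP. Qed.

Lemma vec0E A (v : 'I_0 -> A) : v = vec0 A.
Proof. by apply: funext => -[]. Qed.

Lemma vcons0 A k (x : A) (v : 'I_k -> A) : vcons x v ord0 = x.
Proof. by rewrite /vcons unlift_none. Qed.

Lemma vconsS A k (x : A) (v : 'I_k -> A) i : vcons x v (lift ord0 i) = v i.
Proof. by rewrite /vcons liftK. Qed.

Lemma vhd_vcons A k (x : A) (v : 'I_k -> A) : vhd (vcons x v) = x.
Proof. exact: vcons0. Qed.

Lemma vtl_vcons A k (x : A) (v : 'I_k -> A) : vtl (vcons x v) = v.
Proof. by apply: funext => i; apply: vconsS. Qed.

Let vecE := (map_vcons, vhd_vcons, vtl_vcons, vcons0, vconsS).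

Lemma star_leq_trans (x y z : M) :
  starR2 leq x y -> starR2 leq y z -> starR2 leq x z.
Proof.
pose le i j : formula L_all 3 :=
  FRel (rl2 leq) (vec2 (Var L_all i) (Var L_all j)).
pose i1 : 'I_3 := lift ord0 ord0; pose i2 : 'I_3 := lift ord0 (lift ord0 ord0).
have H e : sat (M := natS) (FOr (FNot (FAnd (le ord0 i1) (le i1 i2))) (le ord0 i2)) e.
  rewrite /= /rl2 /vec2 /vec1 !vecE /=.
  case: (leqP (e ord0) (e i1)) => [le01|_]; last by left => -[].
  case: (leqP (e i1) (e i2)) => [le12|_]; last by left => -[].
  by right; apply: leq_trans le12.
have := transfer H (vec3 x y z); rewrite /= /vec2 /vec1 !vecE !(vec0E (fun _ => _)).
rewrite /= /i1 /i2 /vec3 /vec2 /vec1 !vecE.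
by case=> [nle le1 le2|//]; case: nle.
Qed.

Lemma star_leq_arg k (f : fsym L_all k) (i : 'I_k) : (forall v, f v <= v i) ->
  forall v : 'I_k -> M, starR2 leq (fint M f v) (v i).
Proof.
move=> fi v; pose phi : formula L_all k :=
  FRel (rl2 leq) (vec2 (Fun f (fun j => Var L_all j)) (Var L_all i)).
have H e : sat (M := natS) phi e by rewrite /= /rl2 /vec2 /vec1 !vecE; apply: fi.
by have := transfer H v; rewrite /= /vec2 /vec1 !vecE !(vec0E (fun _ => _)).
Qed.

Lemma star0_leq c (f : nat -> nat) : (forall a, c <= f a) ->
  forall x : M, starR2 leq (star0 c) (star1 f x).
Proof.
move=> cf x; pose phi : formula L_all 1 :=
  FRel (rl2 leq) (vec2 (Fun (fn0 c) (vec0 _))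
                       (Fun (fn1 f) (vec1 (Var L_all ord0)))).
have H e : sat (M := natS) phi e.
  by rewrite /= /rl2 /vec2 /vec1 !vecE /= /fn1 !vecE; apply: cf.
have := transfer H (vec1 x); rewrite /= /vec2 /vec1 !vecE /=.
by rewrite !vecE !(vec0E (fun _ => _)) /= vcons0.
Qed.

Variables (n : M) (Hn : nonstandard n).

Lemma Mn_arg k (f : fsym L_all k) (i : 'I_k) : (forall v, f v <= v i) ->
  forall v : 'I_k -> M, (forall i, Mn n (v i)) -> Mn n (fint M f v).
Proof.
move=> fi v /(_ i)[t tns vit]; exists t => //.
exact: star_leq_trans (star_leq_arg fi v) vit.
Qed.

Lemma Mn_const (c : nat) : c <= 1 ->
  forall v : 'I_0 -> M, (forall i, Mn n (v i)) -> Mn n (fint M (fn0 c) v).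
Proof.
move=> c1 v _; exists n => //; rewrite (vec0E v); apply: star0_leq => a.
by rewrite (leq_trans c1) // expn_gt0.
Qed.

Lemma bitlen_leq m : bitlen m <= m.
Proof. by apply: up_log_min => //; apply: ltn_expl. Qed.

Definition ln0 (c : nat) (c1 : c <= 1) : fsym (L_n n) 0 :=
  exist _ (fn0 c) (Mn_const c1).
Definition ln_bitlen : fsym (L_n n) 1 :=
  exist _ (fn1 bitlen) (Mn_arg (i := ord0) (fun v => bitlen_leq (vhd v))).
Definition ln_sub : fsym (L_n n) 2 :=
  exist _ (fn2 subn)
    (Mn_arg (i := ord0) (fun v => leq_subr (vhd (vtl v)) (vhd v))).

End Transfer.

(** * The retraction weak pigeonhole principle *)

Section RetractionWeakPigeon.
Variables (M : structure L_all) (HM : models_Th M) (n : M) (Hn : nonstandard n).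

(* The free variables are those bound by (forall X)(forall Y)(forall m)(exists x). *)
Local Notation tm := (term2 (L_n n) 2 [:: 0; 0]).
Local Notation fm := (formula2 (L_n n) 2 [:: 0; 0]).
Definition txv : tm := Var2 (@Ordinal 2 0 isT).
Definition tmv : tm := Var2 (@Ordinal 2 1 isT).
Definition tY (t : tm) : tm :=
  @App2 _ 2 [:: 0; 0] (@Ordinal 2 0 isT) (vec1 t).
Definition tX (t : tm) : tm :=
  @App2 _ 2 [:: 0; 0] (@Ordinal 2 1 isT) (vec1 t).

Definition tZero : tm := Fun2 (ln0 HM Hn (leq0n 1)) (vec0 tm).
Definition tOne : tm := Fun2 (ln0 HM Hn (leqnn 1)) (vec0 tm).
Definition tLen (t : tm) : tm := Fun2 (ln_bitlen HM n) (vec1 t).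
(* Truncated; this is immaterial below, as |m| >= 1 if m <> 0. *)
Definition tSub (t u : tm) : tm := Fun2 (ln_sub HM n) (vec2 t u).
Definition fLt (t u : tm) : fm :=
  @Rel2 (L_n n) 2 [:: 0; 0] 2 (rl2 (fun a b => a < b)) (vec2 t u).
Definition fGe (t u : tm) : fm :=
  @Rel2 (L_n n) 2 [:: 0; 0] 2 (rl2 (fun a b => a >= b)) (vec2 t u).

Definition RetractionWeakPigeon : fm :=
  Or2 (Eq2 tmv tZero)
    (And2 (fLt (tLen txv) (tLen tmv))
      (Or2 (fGe (tLen (tX txv)) (tSub (tLen tmv) tOne))
           (Not2 (Eq2 (tY (tX txv)) txv)))).

End RetractionWeakPigeon.

(* Main.v *)
From mathcomp Require Import all_boot all_order all_algebra finmap.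
From mathcomp Require Import boolp classical_sets.
From mathcomp Require Import zify.
Require Import Defs.

(** Fix [X], [Y] in [G_nb] and [m] in [F_nb]; it has to be shown that the truth
    values of the formula at the various [x] in [F_nb] have join [1]. At a sample
    point [w] where [m(w) <> 0] write [l = |m(w)| - 1]. A number [x < 2^l] is no
    witness at [w] only if [X(x) < 2^(l-1)] and [Y(X(x)) = x], and such an [x] is
    determined by [X(x)], so that at least half of the numbers below [2^l] are
    witnesses.

    The join is then reached through its upper bounds. Suppose that the coded set
    [P] represents an upper bound of the truth values, and let [S] be the
    complement of [P]. If [r] is uniform on [0, 2^L) with [L >= l], then
    [r mod 2^l] is uniform on [0, 2^l). Averaging over the points of [S] hence
    gives one number [r] such that [x(w) = r mod 2^(|m(w)| - 1)] is a witness on at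
    least half of [S] ([halving_round]). This [x] is computed by the tree of [m]
    with new labels on the leaves, and [r] can be taken at most the largest label of
    that tree, so [x] is in [F_nb]. As [P] is an upper bound, the part of [S] where
    [x] is a witness is negligible, and thus [S], whose cardinality is at most
    twice as large, is negligible too. So [P] represents [1] ([Bsup_witnessed]).

    Two things make this legitimate. The truth values must be classes of coded
    sets, for which terms like [Y(X(x))] must stay in [F_nb]. That [X(alpha)] is in
    [F_nb] is seen by grafting trees for the functions [gamma_i] of [X] onto the
    leaves of the tree of [alpha]; each [gamma_i] comes with its own bound on the
    depth and on the labels, and the uniform bound is a maximum of costs, which is
    attained at some [i] because the sequence of the [gamma_i] is coded
    ([apply_ftuple_tree], [F_nb_ftuple_app]). And all the combinatorics is carried
    out for standard numbers and moved to the model by transfer, which is reduced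
    to syntax-directed rules so that formulas need not be written down. *)

Set Implicit Arguments.
Unset Strict Implicit.
Unset Printing Implicit Defensive.

Local Open Scope nat_scope.

(** * Transfer between the natural numbers and the model *)

Section Reflection.
Variables (M : structure L_all) (HM : models_Th M).

(** [L_all] names every function on the natural numbers, hence also the one that
    a term defines; the next lemma is the same for relations and formulas. *)
Lemma fint_teval k (t : term L_all k) (e : 'I_k -> M) :
  fint M ((fun v => teval (M := natS) v t) : fsym L_all k) e = teval e t.
Proof.
exact: (transfer HM (phi :=
  FEq (Fun ((fun v => teval (M := natS) v t) : fsym L_all k) (Var L_all (n := k))) t)).
Qed.

Lemma rint_sat k (phi : formula L_all k) (e : 'I_k -> M) :
  rint M ((fun v => sat (M := natS) phi v) : rsym L_all k) e <-> sat phi e.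
Proof.
pose R : formula L_all k :=
  FRel ((fun v => sat (M := natS) phi v) : rsym L_all k) (Var L_all (n := k)).
have H v : sat (M := natS) (FOr (FAnd R phi) (FAnd (FNot R) (FNot phi))) v.
  by rewrite /=; case: (EM (sat (M := natS) phi v)) => H; [left|right].
by have /= := transfer HM H e; tauto.
Qed.

(** The pairs [f], [a] and [R], [P] are the standard and the internal reading of
    one expression in [k] variables. The lemmas [tr_*] below are the rules by
    which such pairs are built along the syntax. *)
Definition function_transfer k (f : fsym L_all k) (a : ('I_k -> M) -> M) : Prop :=
  forall e, fint M f e = a e.
Definition relation_transfer k (R : rsym L_all k) (P : ('I_k -> M) -> Prop) : Prop :=
  forall e, rint M R e <-> P e.
Local Notation TrN := function_transfer.
Local Notation TrP := relation_transfer.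

Lemma tr_var k (i : 'I_k) : TrN (fun v => v i) (fun e => e i).
Proof. exact: (fint_teval (Var _ i)). Qed.

Section Arity.
Variable k : nat.
Implicit Types (f g h : fsym L_all k) (a b c : ('I_k -> M) -> M).
Implicit Types (R S : rsym L_all k) (P Q : ('I_k -> M) -> Prop).

Let atom f : term L_all k := Fun f (Var L_all (n := k)).
Let prop R : formula L_all k := FRel R (Var L_all (n := k)).

Lemma vec_teval (N : structure L_all) (e : 'I_k -> N) :
  ((fun i => teval e (vec0 (term L_all k) i)) = vec0 N) *
  (forall t, (fun i => teval e (vec1 t i)) = vec1 (teval e t)) *
  (forall t u, (fun i => teval e (vec2 t u i)) = vec2 (teval e t) (teval e u)) *
  (forall t u w, (fun i => teval e (vec3 t u w i)) =
    vec3 (teval e t) (teval e u) (teval e w)).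
Proof. by do !split=> *; rewrite /vec3 /vec2 /vec1 ?map_vcons (vec0E (fun _ => _)). Qed.

Lemma tr_const (c : nat) : TrN (k := k) (fun=> c) (fun=> star0 c).
Proof.
move=> e; have := fint_teval (Fun (fn0 c) (vec0 _)) e.
by rewrite /= vec_teval.
Qed.

Lemma tr_fun1 F f a : TrN f a -> TrN (fun v => F (f v)) (fun e => star1 F (a e)).
Proof.
move=> fa e; rewrite -fa.
have := fint_teval (Fun (fn1 F) (vec1 (atom f))) e; rewrite /= vec_teval => H.
apply: etrans H; congr (fint M _ e); apply: funext => v.
by rewrite vec_teval /fn1 vhd_vcons.
Qed.

Lemma tr_fun2 F f g a b : TrN f a -> TrN g b ->
  TrN (fun v => F (f v) (g v)) (fun e => star2 F (a e) (b e)).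
Proof.
move=> fa gb e; rewrite -fa -gb.
have := fint_teval (Fun (fn2 F) (vec2 (atom f) (atom g))) e.
rewrite /= vec_teval => H; apply: etrans H; congr (fint M _ e); apply: funext => v.
by rewrite vec_teval /fn2 vtl_vcons !vhd_vcons.
Qed.

Lemma tr_fun3 F f g h a b c : TrN f a -> TrN g b -> TrN h c ->
  TrN (fun v => F (f v) (g v) (h v)) (fun e => star3 F (a e) (b e) (c e)).
Proof.
move=> fa gb hc e; rewrite -fa -gb -hc.
have := fint_teval (Fun (fn3 F) (vec3 (atom f) (atom g) (atom h))) e.
rewrite /= vec_teval => H; apply: etrans H; congr (fint M _ e); apply: funext => v.
by rewrite vec_teval /fn3 !vtl_vcons !vhd_vcons.
Qed.

Lemma tr_rel2 (R : nat -> nat -> Prop) f g a b : TrN f a -> TrN g b ->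
  TrP (fun v => R (f v) (g v)) (fun e => starR2 R (a e) (b e)).
Proof.
move=> fa gb e; rewrite -fa -gb.
have := rint_sat (FRel (rl2 R) (vec2 (atom f) (atom g))) e.
rewrite /= vec_teval; apply: iff_trans; set r := fun _ => _; set r' := fun _ => _.
have -> // : r = r'; apply: funext => v.
by rewrite /r /r' vec_teval /rl2 vtl_vcons !vhd_vcons.
Qed.

Lemma tr_rel3 (R : nat -> nat -> nat -> Prop) f g h a b c :
  TrN f a -> TrN g b -> TrN h c ->
  TrP (fun v => R (f v) (g v) (h v)) (fun e => starR3 R (a e) (b e) (c e)).
Proof.
move=> fa gb hc e; rewrite -fa -gb -hc.
have := rint_sat (FRel (rl3 R) (vec3 (atom f) (atom g) (atom h))) e.
rewrite /= vec_teval; apply: iff_trans; set r := fun _ => _; set r' := fun _ => _.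
have -> // : r = r'; apply: funext => v.
by rewrite /r /r' vec_teval /rl3 !vtl_vcons !vhd_vcons.
Qed.

Lemma tr_eq f g a b : TrN f a -> TrN g b ->
  TrP (fun v => f v = g v) (fun e => a e = b e).
Proof.
by move=> fa gb e; rewrite -fa -gb; apply: (rint_sat (FEq (atom f) (atom g))).
Qed.

Lemma tr_not R P : TrP R P -> TrP (fun v => ~ R v) (fun e => ~ P e).
Proof. by move=> RP e; rewrite -RP; apply: (rint_sat (FNot (prop R))). Qed.

Lemma tr_and R S P Q : TrP R P -> TrP S Q ->
  TrP (fun v => R v /\ S v) (fun e => P e /\ Q e).
Proof.
by move=> RP SQ e; rewrite -RP -SQ; apply: (rint_sat (FAnd (prop R) (prop S))).
Qed.

Lemma tr_or R S P Q : TrP R P -> TrP S Q ->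
  TrP (fun v => R v \/ S v) (fun e => P e \/ Q e).
Proof.
by move=> RP SQ e; rewrite -RP -SQ; apply: (rint_sat (FOr (prop R) (prop S))).
Qed.

Lemma tr_imp R S P Q : TrP R P -> TrP S Q ->
  TrP (fun v => R v -> S v) (fun e => P e -> Q e).
Proof.
move=> RP SQ e; have := tr_or (tr_not RP) SQ e.
have -> : (fun v => ~ R v \/ S v) = (fun v => R v -> S v).
  by apply: funext => v; rewrite implyE.
by move=> ->; rewrite implyE.
Qed.

Lemma tr_iff R S P Q : TrP R P -> TrP S Q ->
  TrP (fun v => R v <-> S v) (fun e => P e <-> Q e).
Proof. by move=> RP SQ; apply: tr_and; apply: tr_imp. Qed.

End Arity.

(** The bound variable becomes variable 0 of the body. *)
Lemma tr_all k (R : ('I_k -> nat) -> nat -> Prop) (P : ('I_k -> M) -> M -> Prop) :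
  TrP (fun v => R (fun i => v (lift ord0 i)) (v ord0))
      (fun e => P (fun i => e (lift ord0 i)) (e ord0)) ->
  TrP (fun v => forall x, R v x) (fun e => forall x, P e x).
Proof.
move=> RP e; set S : rsym L_all k.+1 := fun v => _ in RP.
have := rint_sat (FAll (FRel S (Var L_all (n := k.+1)))) e.
have vE A (x : A) (v : 'I_k -> A) : (fun i => vcons x v (lift ord0 i)) = v.
  exact: vtl_vcons.
set r := fun _ => _; have -> : r = fun v => forall x, R v x.
  by apply: funext => v; apply: propext; split=> H x; have := H x;
    rewrite /= /S vcons0 vE.
move=> ->; split=> /= H x; have := H x; rewrite /= ?RP ?vcons0 ?vE //.
Qed.

Lemma tr_ex k (R : ('I_k -> nat) -> nat -> Prop) (P : ('I_k -> M) -> M -> Prop) :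
  TrP (fun v => R (fun i => v (lift ord0 i)) (v ord0))
      (fun e => P (fun i => e (lift ord0 i)) (e ord0)) ->
  TrP (fun v => exists x, R v x) (fun e => exists x, P e x).
Proof.
move=> RP e.
have := tr_not (tr_all (R := fun v x => ~ R v x) (P := fun e x => ~ P e x)
  (tr_not RP)) e.
have -> : (fun v => ~ (forall x, ~ R v x)) = fun v => exists x, R v x.
  by apply: funext => v; apply: propext; split=> /not_existsP.
by move=> H; apply: (iff_trans H); split=> /not_existsP.
Qed.

Lemma transfer_true (P Q : Prop) :
  TrP (k := 0) (fun v => P) (fun e => Q) -> P -> Q.
Proof.
move=> PQ HP; apply/(PQ (vec0 M)).
exact: (transfer HM (phi := FRel ((fun=> P) : rsym L_all 0) (Var L_all (n := 0)))).
Qed.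
End Reflection.

(** [transfer_from HM H] proves the internal reading of the statement of [H]. The
    rules are chosen by the shape of the internal side, where every function and
    relation is marked by [star] and is thus recognized without ambiguity. *)
Ltac tr_term HM := cbv beta; lazymatch goal with
  | |- function_transfer _ (fun e => star0 ?c) => refine (tr_const HM c)
  | |- function_transfer _ (fun e => star1 ?F (@?a e)) =>
      refine (tr_fun1 HM F (a := a) _); tr_term HM
  | |- function_transfer _ (fun e => star2 ?F (@?a e) (@?b e)) =>
      refine (tr_fun2 HM F (a := a) (b := b) _ _); tr_term HM
  | |- function_transfer _ (fun e => star3 ?F (@?a e) (@?b e) (@?c e)) =>
      refine (tr_fun3 HM F (a := a) (b := b) (c := c) _ _ _); tr_term HM
  | |- _ => refine (tr_var HM _)
  end.
Ltac tr_formula HM := cbv beta; lazymatch goal with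
  | |- relation_transfer _ (fun e => starR2 ?R (@?a e) (@?b e)) =>
      refine (tr_rel2 HM R (a := a) (b := b) _ _); tr_term HM
  | |- relation_transfer _ (fun e => starR3 ?R (@?a e) (@?b e) (@?c e)) =>
      refine (tr_rel3 HM R (a := a) (b := b) (c := c) _ _ _); tr_term HM
  | |- relation_transfer _ (fun e => ~ @?P e) =>
      refine (tr_not HM (P := P) _); tr_formula HM
  | |- relation_transfer _ (fun e => @?P e /\ @?Q e) =>
      refine (tr_and HM (P := P) (Q := Q) _ _); tr_formula HM
  | |- relation_transfer _ (fun e => @?P e \/ @?Q e) =>
      refine (tr_or HM (P := P) (Q := Q) _ _); tr_formula HM
  | |- relation_transfer _ (fun e => @?P e <-> @?Q e) =>
      refine (tr_iff HM (P := P) (Q := Q) _ _); tr_formula HM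
  | |- relation_transfer _ (fun e => @?a e = @?b e) =>
      refine (tr_eq HM (a := a) (b := b) _ _); tr_term HM
  | |- relation_transfer _ (fun e => @?P e -> @?Q e) =>
      refine (tr_imp HM (P := P) (Q := Q) _ _); tr_formula HM
  | |- relation_transfer _ (fun e => exists x, @?P e x) =>
      refine (tr_ex HM (P := P) _); tr_formula HM
  | |- relation_transfer _ (fun e => forall x, @?P e x) =>
      refine (tr_all HM (P := P) _); tr_formula HM
  end.
Ltac transfer_from HM H := refine (transfer_true HM _ H); tr_formula HM.


(** * Codes and decision trees *)

Lemma pickle_decode (T : countType) (x0 x : T) : decode x0 (choice.pickle x) = x.
Proof. by rewrite /decode choice.pickleK. Qed.

Lemma is_code_pickle (T : countType) (x : T) : is_code T (choice.pickle x).
Proof. by exists x. Qed.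

(** Induction over the subtrees by their position, which is how a computation
    selects one of them. *)
Lemma ltree_ind (P : ltree -> Prop) :
  (forall x, P (GenTree.Leaf x)) ->
  (forall v s, (forall i, i < size s -> P (nth (GenTree.Leaf 0) s i)) ->
     P (GenTree.Node v s)) ->
  forall T, P T.
Proof.
move=> Pleaf Pnode; elim=> // v s IH; apply: Pnode.
elim: s IH => [|t s IHs] //= [Pt /IHs Ps] [|i] //; exact: Ps.
Qed.

Lemma neighbor_lt k w i : in_sample_space k w -> i < k -> neighbor w i < k.
Proof.
move=> /imfsetP[f _ ->] ik; rewrite /neighbor pickle_decode.
set s := [seq _ | _ <- _ & _].
have s_lt x : x \in s -> x < k.
  move=> /mapP[e]; rewrite mem_filter => /andP[_ /imfsetP[j _ ->]] -> /=.
  by apply: leq_trans (ltn_ord (f j)) _; lia.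
suff : s != [::] by case: s s_lt => //= x s -> //; rewrite mem_head.
apply/eqP => s0; suff : val (f (Ordinal ik)) \in s by rewrite s0.
apply/mapP; exists (i, val (f (Ordinal ik))) => //.
rewrite mem_filter eqxx; apply/imfsetP; by exists (Ordinal ik).
Qed.

Lemma leaves_node v (s : seq ltree) x :
  x \in leaves (GenTree.Node v s) <->
  exists2 i, i < size s & x \in leaves (nth (GenTree.Leaf 0) s i).
Proof.
split=> [/flatten_mapP[t /(nthP (GenTree.Leaf 0))[i ilt <-]] xi|[i ilt xi]].
  by exists i.
by apply/flatten_mapP; exists (nth (GenTree.Leaf 0) s i) => //; rewrite mem_nth.
Qed.

Lemma depth_node v (s : seq ltree) d :
  depth (GenTree.Node v s) <= d.+1 <->
  forall i, i < size s -> depth (nth (GenTree.Leaf 0) s i) <= d.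
Proof.
rewrite [depth _]/= ltnS; elim: s => [|t s IHs] //=.
rewrite geq_max; split=> [/andP[td /IHs sd] [|i] //= /sd //|H].
by rewrite (H 0) //=; apply/IHs => i; apply: (H i.+1).
Qed.

Lemma run_node w v (s : seq ltree) : neighbor w v < size s ->
  run w (GenTree.Node v s) = run w (nth (GenTree.Leaf 0) s (neighbor w v)).
Proof. by move=> H; rewrite /= (nth_map (GenTree.Leaf 0)). Qed.

Lemma wf_node k v (s : seq ltree) : wf_tree k (GenTree.Node v s) ->
  [/\ v < k, size s = k & forall i, i < k -> wf_tree k (nth (GenTree.Leaf 0) s i)].
Proof. by move=> /= /and3P[vk /eqP sk /(all_nthP (GenTree.Leaf 0))]; rewrite sk. Qed.

Lemma run_leaf k w T : in_sample_space k w -> wf_tree k T -> run w T \in leaves T.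
Proof.
move=> wk; elim/ltree_ind: T => [x _|v s IH]; first by rewrite mem_head.
move=> /wf_node[vk sk swf]; have nk := neighbor_lt wk vk.
by rewrite run_node ?sk //; apply/leaves_node; exists (neighbor w v);
  rewrite ?sk //; apply: IH; rewrite ?sk // swf.
Qed.

(** Sequential composition of computations: first [T], then the tree which its
    result selects. *)
Fixpoint bind (h : nat -> ltree) (T : ltree) : ltree :=
  match T with
  | GenTree.Leaf x => h x
  | GenTree.Node v s => GenTree.Node v [seq bind h t | t <- s]
  end.

Section Bind.
Variables (k : nat) (h : nat -> ltree).

Lemma wf_bind T : (forall x, wf_tree k (h x)) -> wf_tree k T -> wf_tree k (bind h T).
Proof.
move=> hwf; elim/ltree_ind: T => [x _|v s IH /wf_node[vk sk swf]]; first exact: hwf.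
rewrite /= vk size_map sk eqxx; apply/(all_nthP (GenTree.Leaf 0)) => i.
by rewrite size_map => ilt; rewrite (nth_map (GenTree.Leaf 0)) // IH // swf -?sk.
Qed.

Lemma run_bind w T : in_sample_space k w -> wf_tree k T ->
  run w (bind h T) = run w (h (run w T)).
Proof.
move=> wk; elim/ltree_ind: T => [x _|v s IH /wf_node[vk sk swf]] //.
have nk := neighbor_lt wk vk; rewrite -/bind [bind _ _]/= !run_node ?size_map ?sk //.
by rewrite (nth_map (GenTree.Leaf 0)) ?sk // IH ?sk // swf.
Qed.

Lemma depth_bind D T : (forall x, depth (h x) <= D) ->
  depth (bind h T) <= depth T + D.
Proof.
move=> hD; elim/ltree_ind: T => [x|v s IH]; first exact: hD.
have -> : depth (GenTree.Node v s) = (depth (GenTree.Node v s)).-1.+1 by [].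
rewrite addSn [bind _ _]/=; apply/depth_node => i; rewrite size_map => ilt.
rewrite (nth_map (GenTree.Leaf 0)) //; apply: leq_trans (IH i ilt) _.
by rewrite leq_add2r; move: i ilt; apply/(depth_node v).
Qed.

Lemma leaves_bind T x : x \in leaves (bind h T) ->
  exists2 y, y \in leaves T & x \in leaves (h y).
Proof.
elim/ltree_ind: T x => [y|v s IH] x; first by exists y => //; rewrite mem_head.
rewrite [bind _ _]/= => /leaves_node[i]; rewrite size_map => ilt.
rewrite (nth_map (GenTree.Leaf 0)) // => /(IH _ ilt)[y ys xy].
by exists y => //; apply/leaves_node; exists i.
Qed.

End Bind.

Lemma compute_leaf k d T w : is_tree k d T -> in_sample_space k w ->
  leaf_label T (compute T w).
Proof. by move=> [_ [Twf _]] wk; apply: run_leaf wk Twf. Qed.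

Lemma max_leaf T : exists B, (B = 0 \/ leaf_label T B) /\
  forall x, leaf_label T x -> x <= B.
Proof.
rewrite /leaf_label; elim: (leaves _) => [|y s [B [BT leB]]].
  by exists 0; split; [left|].
exists (maxn y B); split.
  case: (leqP y B) => [yB|By]; last by right; rewrite mem_head.
  by case: BT => [->|Bs]; [left|right; rewrite inE Bs orbT].
by move=> x; rewrite inE leq_max => /orP[/eqP->|/leB->]; rewrite ?leqnn ?orbT.
Qed.

(** The fixed number [r], reduced to the range of the possible witnesses for [m].
    It is at most [r] whatever [m] is, so the trees that output it have their
    labels in the cut as soon as [r] is there. *)
Definition residue (r m : nat) : nat := r %% 2 ^ (bitlen m).-1.

Lemma residue_tree k d T r : is_tree k d T ->
  exists T', is_tree k d T' /\ (forall x, leaf_label T' x -> x <= r) /\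
    forall w, in_sample_space k w -> compute T' w = residue r (compute T w).
Proof.
move=> [_ [Twf Td]]; pose h x : ltree := GenTree.Leaf (residue r x).
exists (choice.pickle (bind h (decode_tree T))).
rewrite /is_tree /leaf_label /compute /decode_tree pickle_decode.
split; [split; [exact: is_code_pickle|split]|split].
- exact: wf_bind.
- apply: leq_trans (depth_bind (D := 0) _ _) _ => //; by rewrite addn0.
- by move=> x /leaves_bind[y _]; rewrite inE => /eqP->; apply: leq_mod.
- by move=> w wk; rewrite (run_bind _ wk).
Qed.

(** A single number bounds depth and labels: both [n^(1/t)] and [2^(n^(1/t))], the
    bounds in the definition of [T_nb], are governed by [n^(1/t)]. *)
Definition computable_at_cost (k g i c : nat) : Prop :=
  exists T, is_tree k c T /\ (forall x, leaf_label T x -> x <= exp2 c) /\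
    forall w, in_sample_space k w -> compute T w = ftuple_app g i w.

Lemma ftuple_app_default m g i w : is_ftuple m g -> ~ i < m -> ftuple_app g i w = 0.
Proof. by move=> [_ sg] im; rewrite /ftuple_app nth_default ?sg ?fnd_fmap0 //; lia. Qed.

(** Trees of least cost for the entries of the tuple are grafted onto [T]. The
    bound [D] is either 0 or the least cost of one of the entries; in the model
    this makes [D] small although every entry is only known to have some small
    cost. *)
Lemma apply_ftuple_tree k g m T d : is_ftuple m g -> is_tree k d T ->
  (forall i, i < m -> exists c, computable_at_cost k g i c) ->
  exists T' D, is_tree k (d + D) T' /\ (forall x, leaf_label T' x -> x <= exp2 D) /\
    (forall w, in_sample_space k w -> compute T' w = ftuple_app g (compute T w) w) /\
    (D = 0 \/ exists i, i < m /\ forall c, computable_at_cost k g i c -> D <= c).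
Proof.
move=> gm [_ [Twf Td]] cost.
have /choice[c cP] i : exists c, i < m -> computable_at_cost k g i c /\
    forall c', computable_at_cost k g i c' -> c <= c'.
  have [im|im] := boolP (i < m); last by exists 0.
  have exc : exists c, `[< computable_at_cost k g i c >].
    by have [c Hc] := cost i im; exists c; apply/asboolP.
  have [c /asboolP Hc cmin] := ex_minnP exc.
  by exists c => _; split=> // c' Hc'; apply: cmin; apply/asboolP.
have /choice[t tP] i : exists t, i < m -> is_tree k (c i) t /\
    (forall x, leaf_label t x -> x <= exp2 (c i)) /\
    forall w, in_sample_space k w -> compute t w = ftuple_app g i w.
  have [im|im] := boolP (i < m); last by exists 0.
  by have [[t Ht] _] := cP i im; exists t.
pose D := \max_(i < m) c i.
have cD i : i < m -> c i <= D by move=> im; apply: (leq_bigmax (Ordinal im)).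
pose h x : ltree := if x < m then decode_tree (t x) else GenTree.Leaf 0.
exists (choice.pickle (bind h (decode_tree T))), D.
rewrite /is_tree /leaf_label /compute /decode_tree pickle_decode.
split; [split; [exact: is_code_pickle|split]|split; [|split]].
- by apply: wf_bind => // x; rewrite /h; case: ifP => // /tP[[_ []]].
- apply: leq_trans (depth_bind (D := D) _ _) _; last by rewrite leq_add2r.
  move=> x; rewrite /h; case: ifP => // xm; have [[_ [_ H]] _] := tP x xm.
  exact: leq_trans H (cD x xm).
- move=> x /leaves_bind[y _]; rewrite /h; case: ifP => ym; last first.
    by rewrite inE => /eqP ->.
  have [_ [H _]] := tP y ym; move=> /H H'; apply: leq_trans H' _.
  by rewrite leq_exp2l // cD.
- move=> w wk; rewrite (run_bind _ wk) //; set x := run w (decode (GenTree.Leaf 0) T).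
  rewrite /h; case: ifP => xm; last by rewrite (ftuple_app_default w gm) ?xm.
  by have [_ [_ /(_ w wk)]] := tP x xm.
- case: (posnP m) => [m0|m0]; first by left; rewrite /D m0 big_ord0.
  have /(eq_bigmax (fun i : 'I_m => c i))[i Hi] : 0 < #|'I_m| by rewrite card_ord.
  right; exists i; split; first exact: ltn_ord.
  by move=> c' Hc'; rewrite /D Hi; apply: (proj2 (cP i (ltn_ord i))).
Qed.

Lemma leq_iroot t k a : a ^ t <= k -> 0 < t -> a <= iroot t k.
Proof.
move=> ak t0; have ak1 : a < k.+1.
  rewrite ltnS; apply: leq_trans ak.
  by case: a => [|a]; rewrite ?exp0n // -{1}(expn1 a.+1) leq_pexp2l.
exact: (leq_bigmax_cond (Ordinal ak1)).
Qed.

Lemma iroot_exp t k : 0 < t -> iroot t k ^ t <= k.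
Proof.
move=> t0; rewrite /iroot; apply: (big_ind (fun r => r ^ t <= k)) => //=.
- by rewrite exp0n.
- by move=> x y xk yk; case: (leqP x y).
Qed.

(** A bound that is standard at standard numbers: if [t] in [iroot_add] were
    standard, one of [t1], [t2], [k] would be standard as well. *)
Definition wide (t : nat) : nat := 2 ^ t.+2.

(** Halving [t] squares [k^(1/t)], which at least doubles it unless it is 1; the
    bound by [log k] on [t] settles that case. *)
Lemma iroot_add t1 t2 k a b : 1 < t1 -> 1 < t2 -> 1 < k ->
  a <= iroot t1 k -> b <= iroot t2 k ->
  exists t, a + b <= iroot t k /\ (t1 <= wide t \/ t2 <= wide t \/ k <= wide t).
Proof.
move=> t1_gt1 t2_gt1 k_gt1 ak bk.
pose s := minn t1 t2; pose t := minn s./2 (trunc_log 2 k); exists t.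
have logk : 0 < trunc_log 2 k by rewrite trunc_log_gt0.
have s1 : 1 < s by rewrite leq_min t1_gt1.
have t0 : 0 < t by rewrite leq_min logk half_gt0 s1.
split.
  have root_s c u : s <= u -> 0 < u -> c <= iroot u k -> c ^ s <= k.
    move=> su u0 cu; case: (posnP c) => [->|c0]; first by rewrite exp0n // ltnW.
    apply: leq_trans (iroot_exp k u0).
    by apply: leq_trans (leq_pexp2l c0 su) _; rewrite leq_exp2r.
  have [c [abc ck]] : exists c, a + b <= c.*2 /\ c ^ s <= k.
    exists (maxn a b); split; first by lia.
    by case: (leqP a b) => _; [apply: (root_s _ t2)|apply: (root_s _ t1)] => //; lia.
  apply: leq_trans abc _; apply: leq_iroot => //.
  have [c1|c1] := leqP c 1.
    apply: leq_trans (trunc_logP (isT : 1 < 2) (ltnW k_gt1)).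
    apply: (@leq_trans (2 ^ t)); first by rewrite leq_exp2r //; lia.
    by rewrite leq_exp2l // geq_minr.
  apply: leq_trans ck; apply: (@leq_trans ((c ^ 2) ^ t)).
    by rewrite leq_exp2r // -mul2n -mulnn leq_mul2r c1 orbT.
  by rewrite -expnM leq_exp2l // mul2n; lia.
have : t.*2.+1 < wide t.
  by rewrite /wide; have := ltn_expl t (isT : 1 < 2); rewrite !expnS; lia.
have [Hs|Hk] : t = s./2 \/ t = trunc_log 2 k by lia.
  by have := odd_double_half s; rewrite -Hs; lia.
move=> _; right; right; rewrite Hk; apply: ltnW.
apply: leq_trans (trunc_log_ltn k (isT : 1 < 2)) _.
by rewrite /wide leq_exp2l.
Qed.

(** * Counting *)

Section Ratio.
Import Order.TTheory GRing.Theory Num.Theory.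
Local Open Scope ring_scope.

Lemma ratio_lt_add k a b c N : (0 < k)%N -> (c <= a + b)%N ->
  ratio_lt (k * 2) a N -> ratio_lt (k * 2) b N -> ratio_lt k c N.
Proof.
rewrite /ratio_lt => k0 cab aN bN.
have -> : k%:R^-1 = (k * 2)%:R^-1 + (k * 2)%:R^-1 :> rat.
  by rewrite natrM invfM; apply: splitr.
apply: le_lt_trans (ltrD aN bN); rewrite -mulrDl ler_wpM2r //.
  by rewrite invr_ge0 ler0n.
by rewrite -natrD ler_nat.
Qed.

Lemma ratio_lt0 k N : (0 < k)%N -> ratio_lt k 0 N.
Proof. by move=> k0; rewrite /ratio_lt mul0r invr_gt0 ltr0n. Qed.

End Ratio.

Lemma comprehension k (P : nat -> Prop) :
  exists c, forall x, set_mem x c <-> in_sample_space k x /\ P x.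
Proof.
exists (choice.pickle [fset x in sample_space k | `[< P x >]]%fset) => x.
rewrite /set_mem pickle_decode !inE /=; split; first by case/andP=> ? /asboolP.
by move=> [xk Px]; apply/andP; split=> //; apply/asboolP.
Qed.

Lemma set_card_cover a b c :
  (forall x, set_mem x c -> set_mem x a \/ set_mem x b) ->
  set_card c <= set_card a + set_card b.
Proof.
rewrite /set_mem /set_card; set A := decode _ a; set B := decode _ b => H.
apply: (@leq_trans #|` A `|` B|%fset); last by rewrite cardfsU leq_subr.
by apply: fsubset_leq_card; apply/fsubsetP => x /H xAB; rewrite inE; apply/orP.
Qed.

Lemma set_card_empty c : (forall x, ~ set_mem x c) -> set_card c = 0.
Proof.
rewrite /set_mem /set_card => H; apply/eqP; rewrite cardfs_eq0; apply/eqP.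
by apply/fsetP => x; rewrite inE; apply/negP/H.
Qed.

Lemma bitlen_le x l : (bitlen x <= l) = (x < 2 ^ l).
Proof.
apply/idP/idP => [|xl]; last exact: up_log_min.
by move=> xl; apply: leq_trans (up_logP x.+1 (isT : 1 < 2)) _; rewrite leq_exp2l.
Qed.

Lemma bitlen_lt x l : (bitlen x < l) = (0 < l) && (x < 2 ^ l.-1).
Proof. by case: l => // l; rewrite ltnS bitlen_le. Qed.

Lemma bitlen_gt0 x : (0 < bitlen x) = (0 < x).
Proof. by rewrite lt0n -leqn0 bitlen_le; case: x. Qed.

Lemma bitlen_residue r m : 0 < m -> bitlen (residue r m) < bitlen m.
Proof.
move=> m0; have l0 : 0 < bitlen m by rewrite bitlen_gt0.
by rewrite -[ltnRHS]prednK // ltnS bitlen_le ltn_pmod // expn_gt0.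
Qed.

(** A failing [r] is determined by the [l-1] bits of [X (r mod 2^l)], from which [Y]
    recovers [r mod 2^l], and by the [P-l] bits of [r / 2^l]. *)
Lemma card_retraction_failures P l (X Y : nat -> nat) : 0 < l <= P ->
  2 * #|[set r : 'I_(2 ^ P) | (X (r %% 2 ^ l) < 2 ^ l.-1) &&
                              (Y (X (r %% 2 ^ l)) == r %% 2 ^ l)]| <= 2 ^ P.
Proof.
move=> /andP[l0 lP]; set F := [set r | _]; pose N := 2 ^ P.-1.
have N0 : 0 < N by rewrite expn_gt0.
have NE : N = 2 ^ l.-1 * 2 ^ (P - l) by rewrite -expnD; congr (2 ^ _); lia.
have PE : 2 ^ P = 2 ^ (P - l) * 2 ^ l by rewrite -expnD subnK.
pose code (r : nat) := X (r %% 2 ^ l) + r %/ 2 ^ l * 2 ^ l.-1.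
have code_lt (r : 'I_(2 ^ P)) : r \in F -> code r < N.
  rewrite inE => /andP[Xr _]; have : r %/ 2 ^ l < 2 ^ (P - l).
    by rewrite ltn_divLR ?expn_gt0 // -PE.
  by rewrite NE /code; nia.
pose f (r : 'I_(2 ^ P)) : 'I_N := insubd (Ordinal N0) (code r).
have f_inj : {in F &, injective f}.
  move=> r r' rF r'F /(congr1 val); rewrite !val_insubd !code_lt // => codeE.
  move: rF r'F; rewrite !inE => /andP[Xr /eqP Yr] /andP[Xr' /eqP Yr'].
  have := edivn_eq (r %/ 2 ^ l) Xr; rewrite addnC -/(code r) codeE /code addnC.
  rewrite (edivn_eq _ Xr') => -[qE XE]; apply: val_inj => /=.
  by rewrite (divn_eq r (2 ^ l)) (divn_eq r' (2 ^ l)) qE -Yr -Yr' XE.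
have NP : 2 ^ P = 2 * N by rewrite -expnS prednK // (leq_trans l0).
rewrite [leqRHS]NP leq_mul2l /= -(card_in_imset f_inj) -[X in _ <= X]card_ord.
exact: max_card.
Qed.

Lemma exists_below_average n K (c : 'I_n -> nat) : 0 < n ->
  \sum_(r < n) c r <= K * n -> exists r, c r <= K.
Proof.
move=> n0; apply: contraPP => /forallNP cK; apply/negP; rewrite -ltnNge.
have -> : K * n = \sum_(r < n) K by rewrite sum_nat_const card_ord mulnC.
rewrite -subn_gt0 -sumnB; last by move=> i _; have /negP := cK i; lia.
rewrite (bigD1 (Ordinal n0)) //=; have /negP := cK (Ordinal n0); lia.
Qed.

(** For every [w] in [s] at most half of the numbers below [2^(|B| - 1)] are
    failures; the number [r] is one that fails at no more points than the
    average. *)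
Lemma halving_round s gX gY T B :
  (forall w, set_mem w s -> compute T w <= B) ->
  exists r, r <= B /\ forall a,
    (forall w, set_mem w s -> set_mem w a \/
       (~ (compute T w = 0) /\
        bitlen (ftuple_app gX (residue r (compute T w)) w) < bitlen (compute T w) - 1 /\
        ftuple_app gY (ftuple_app gX (residue r (compute T w)) w) w =
          residue r (compute T w))) ->
    set_card s <= set_card a + set_card a.
Proof.
rewrite /set_mem /set_card; set D := decode _ s => leB.
pose fail (r w : nat) := [&& compute T w != 0,
  bitlen (ftuple_app gX (residue r (compute T w)) w) < bitlen (compute T w) - 1 &
  ftuple_app gY (ftuple_app gX (residue r (compute T w)) w) w ==
    residue r (compute T w)].
(* [P >= |m| - 1] for the values [m] at the points of [s], and [2 ^ P <= B] if [B > 0]. *)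
pose P := (bitlen B).-1.
have fail_half w : w \in D -> 2 * \sum_(r < 2 ^ P) fail r w <= 2 ^ P.
  move=> wD; set m := compute T w; have mB : m <= B := leB w wD.
  (* If [|m| = 1], then [|X x| < |m| - 1] is impossible. *)
  have [ml|l0] := posnP (bitlen m).-1.
    rewrite big1 ?muln0 // => r _; rewrite /fail -/m.
    by case: andP => // -[_ /andP[]]; rewrite subn1 ml.
  have lP : (bitlen m).-1 <= P by rewrite /P -!subn1 leq_sub2r // leq_up_log.
  have := card_retraction_failures (P := P) (l := (bitlen m).-1)
    (ftuple_app gX ^~ w) (ftuple_app gY ^~ w).
  rewrite l0 lP => /(_ isT); apply: leq_trans; rewrite leq_mul2l /=.
  rewrite -sum1_card [leqRHS]big_mkcond /=; apply: leq_sum => r _.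
  rewrite inE /fail -/m /residue subn1; case: and3P => // -[_ Xr /eqP ->].
  by move: Xr; rewrite bitlen_lt => /andP[_ ->]; rewrite eqxx.
have [||r rK] := @exists_below_average (2 ^ P) (size D)
  (fun r => 2 * \sum_(w <- D) fail r w); [by rewrite expn_gt0| |].
  rewrite -big_distrr /= exchange_big /= big_distrr /= -sum1_size big_distrl /=.
  by rewrite !big_seq; apply: leq_sum => w wD; rewrite mul1n fail_half.
exists r; split.
  have : r < 2 ^ P := ltn_ord r; move: (nat_of_ord r) => j; rewrite /P.
  have [->|B0] := posnP B; first by rewrite /bitlen up_log1 expn0; lia.
  have : ~~ (B < 2 ^ (bitlen B).-1).
    by rewrite -bitlen_le -ltnNge prednK // bitlen_gt0.
  lia.
move=> a Ha; set A := decode _ a.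
have : size (filter (fun w => ~~ fail r w) D) <= #|` A|.
  apply: uniq_leq_size; first by rewrite filter_uniq ?fset_uniq.
  move=> w; rewrite mem_filter => /andP[nf wD].
  case: (Ha w wD) => // -[m0 [Xw Yw]].
  by case/negP: nf; apply/and3P; split; [apply/eqP| |apply/eqP].
have sumE : \sum_(w <- D) fail r w = count (fail r) D.
  by rewrite -sum1_count [RHS]big_mkcond /=; apply: eq_bigr => w _; case: (fail r w).
move: rK; rewrite sumE size_filter; have := count_predC (fail r) D.
move=> /= E rK H; rewrite -E in rK *; move: rK H.
by set c := count (fail r) _; set c' := count _ _; lia.
Qed.

(** * The cut and the families of random functions *)

Local Open Scope classical_set_scope.

Section Model.
Variables (M : structure L_all) (HM : models_Th M) (n : M) (Hn : nonstandard n).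
Local Notation "x <=* y" := (starR2 leq x y) (at level 70).
Local Notation "x <* y" := (starR2 (fun a b => a < b) x y) (at level 70).

Lemma star1_star0 f c : star1 f (star0 c) = star0 (f c) :> M.
Proof. by transfer_from HM (erefl (f c)). Qed.

Lemma star_leqnn (x : M) : x <=* x.
Proof. by move: x; transfer_from HM leqnn. Qed.

Lemma star_leq0 (x : M) : star0 0 <=* x.
Proof. by move: x; transfer_from HM leq0n. Qed.

Lemma star_leq_or_gt (x y : M) : y <=* x \/ x <* y.
Proof.
have H a b : b <= a \/ a < b by lia.
by move: x y; transfer_from HM H.
Qed.

Lemma standard_below (c : nat) (x : M) : x <=* star0 c -> exists c', x = star0 c'.
Proof.
elim: c => [|c IH] xc.
  have H y : y <= 0 -> y = 0 by lia.
  by exists 0; move: x xc; transfer_from HM H.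
have H y : y <= c.+1 -> y = c.+1 \/ y <= c by lia.
have [->|/IH//] : x = star0 c.+1 \/ x <=* star0 c.
  by move: x xc {IH}; transfer_from HM H.
by exists c.+1.
Qed.

Lemma nonstandard_gt (c : nat) (t : M) : nonstandard t -> star0 c <* t.
Proof.
by move=> tns; case: (star_leq_or_gt (star0 c) t) => // /standard_below[c' /tns].
Qed.

(** The common scale of the depths and of the binary logarithms of the labels. *)
Definition small (d : M) : Prop :=
  exists2 t, nonstandard t & d <=* star2 iroot t n.

Lemma small0 : small (star0 0).
Proof. by exists n => //; apply: star_leq0. Qed.

Lemma small_iroot (t : M) : nonstandard t -> small (star2 iroot t n).
Proof. by move=> tns; exists t => //; apply: star_leqnn. Qed.

Lemma small_leq (d d' : M) : d <=* d' -> small d' -> small d.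
Proof. by move=> dd' [t tns dt]; exists t => //; apply: (star_leq_trans HM) dd' dt. Qed.

Lemma small_add (a b : M) : small a -> small b -> small (star2 addn a b).
Proof.
move=> [t1 ns1 a1] [t2 ns2 b2].
have H : forall t1 t2 k a b : M,
    star0 1 <* t1 -> star0 1 <* t2 -> star0 1 <* k ->
    a <=* star2 iroot t1 k -> b <=* star2 iroot t2 k ->
    exists t, star2 addn a b <=* star2 iroot t k /\
      (t1 <=* star1 wide t \/ t2 <=* star1 wide t \/ k <=* star1 wide t).
  by transfer_from HM iroot_add.
have [|||t [abt wt]] := H t1 t2 n a b _ _ _ a1 b2; try exact: nonstandard_gt.
exists t => // c tc; move: wt; rewrite tc star1_star0.
case=> [|[]] /standard_below[c' e].
- exact: (ns1 c').
- exact: (ns2 c').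
- exact: (Hn (c := c')).
Qed.

Lemma Mn_small (x : M) : Mn n x <-> exists2 d, small d & x <=* star1 exp2 d.
Proof.
split=> [[t tns xt]|[d [t tns dt] xd]].
  by exists (star2 iroot t n) => //; apply: small_iroot.
exists t => //; apply: (star_leq_trans HM) xd _.
have H a b : a <= b -> exp2 a <= exp2 b by move=> ab; rewrite leq_exp2l.
have HsM : forall a b : M, a <=* b -> star1 exp2 a <=* star1 exp2 b.
  by transfer_from HM H.
exact: HsM dt.
Qed.

Lemma Mn_leq (x y : M) : x <=* y -> Mn n y -> Mn n x.
Proof. by move=> xy [t tns yt]; exists t => //; apply: (star_leq_trans HM) xy yt. Qed.

Lemma Mn0 : Mn n (star0 0).
Proof. by exists n => //; apply: star_leq0. Qed.

Lemma star_max_leaf (T : M) : exists B,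
  (B = star0 0 \/ starR2 leaf_label T B) /\
  forall x, starR2 leaf_label T x -> x <=* B.
Proof. by move: T; transfer_from HM max_leaf. Qed.

Lemma star_compute_leaf (d T : M) (w : Omega n) : starR3 is_tree n d T ->
  starR2 leaf_label T (star2 compute T (sval w)).
Proof.
have H : forall k d T w : M, starR3 is_tree k d T ->
    starR2 in_sample_space k w -> starR2 leaf_label T (star2 compute T w).
  by transfer_from HM compute_leaf.
by move=> Tt; apply: H Tt _; apply: svalP w.
Qed.

Lemma is_tree_leq (d d' T : M) : d <=* d' -> starR3 is_tree n d T ->
  starR3 is_tree n d' T.
Proof.
have H a b k c : a <= b -> is_tree k a c -> is_tree k b c.
  by move=> ab [cc [cwf ca]]; split=> //; split=> //; apply: leq_trans ab.
suff HsM : forall a b k c : M,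
    a <=* b -> starR3 is_tree k a c -> starR3 is_tree k b c by exact: HsM.
by transfer_from HM H.
Qed.

(** Each label of a tree in [T_nb] has a bound [2^(n^(1/t))] of its own; the bound
    of the largest label serves for all of them. *)
Lemma T_nb_cost (T : M) : T_nb n T -> exists c, small c /\
  starR3 is_tree n c T /\ forall x, starR2 leaf_label T x -> x <=* star1 exp2 c.
Proof.
move=> [[t tns Tt] Tx]; have [B [BT leB]] := star_max_leaf T.
have [e esm Be] : exists2 e, small e & B <=* star1 exp2 e.
  by apply/Mn_small; case: BT => [->|/Tx//]; apply: Mn0.
exists (star2 addn (star2 iroot t n) e).
split; first by apply: small_add => //; apply: small_iroot.
have leqDr : forall a b : M, a <=* star2 addn a b.
  by have H a b : a <= a + b := leq_addr b a; transfer_from HM H.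
split; first exact: is_tree_leq Tt.
move=> x /leB xB; apply: (star_leq_trans HM) xB _; apply: (star_leq_trans HM) Be _.
have H a b : exp2 b <= exp2 (a + b) by rewrite leq_exp2l // leq_addl.
suff HsM : forall a b : M, star1 exp2 b <=* star1 exp2 (star2 addn a b).
  exact: HsM.
by transfer_from HM H.
Qed.

Lemma F_nb_residue (r : M) alpha : Mn n r -> F_nb alpha ->
  F_nb (fun w : Omega n => star2 residue r (alpha w)).
Proof.
move=> rM [T [[t tns Tt] _] aT].
have H : forall k d T r : M, starR3 is_tree k d T ->
    exists T', starR3 is_tree k d T' /\
      (forall x, starR2 leaf_label T' x -> x <=* r) /\
      forall w, starR2 in_sample_space k w ->
        star2 compute T' w = star2 residue r (star2 compute T w).
  by transfer_from HM residue_tree.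
have [T' [T't [T'r T'c]]] := H n _ T r Tt; exists T'.
  by split; [exists t|move=> x /T'r xr; apply: Mn_leq xr rM].
by move=> w; rewrite aT T'c //; apply: (svalP w).
Qed.

Definition star_computable_at_cost (k g i c : M) : Prop :=
  exists T, starR3 is_tree k c T /\
    (forall x, starR2 leaf_label T x -> x <=* star1 exp2 c) /\
    forall w, starR2 in_sample_space k w -> star2 compute T w = star3 ftuple_app g i w.

Lemma star_apply_ftuple_tree (k g m T d : M) :
  starR2 is_ftuple m g -> starR3 is_tree k d T ->
  (forall i, i <* m -> exists c, star_computable_at_cost k g i c) ->
  exists T' D, starR3 is_tree k (star2 addn d D) T' /\
    (forall x, starR2 leaf_label T' x -> x <=* star1 exp2 D) /\
    (forall w, starR2 in_sample_space k w ->
       star2 compute T' w = star3 ftuple_app g (star2 compute T w) w) /\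
    (D = star0 0 \/ exists i, i <* m /\
       forall c, star_computable_at_cost k g i c -> D <=* c).
Proof.
move: k g m T d; have H := apply_ftuple_tree.
rewrite /computable_at_cost in H; rewrite /star_computable_at_cost.
by transfer_from HM H.
Qed.

Lemma F_nb_ftuple_app (m g : M) alpha : starR2 is_ftuple m g ->
  (forall i, i <* m -> F_nb (fun w : Omega n => star3 ftuple_app g i (sval w))) ->
  F_nb alpha -> F_nb (fun w : Omega n => star3 ftuple_app g (alpha w) (sval w)).
Proof.
move=> gm gF [T /T_nb_cost[d [dsm [Td _]]] aT].
have cost i : i <* m -> exists c, small c /\ star_computable_at_cost n g i c.
  move=> /gF[Ti /T_nb_cost[c [csm [Tic Tix]]] giT]; exists c; split=> //; exists Ti.
  by split=> //; split=> // w wn; rewrite (giT (exist _ w wn)).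
have [|T' [D [T'd [T'x [T'c HD]]]]] := star_apply_ftuple_tree gm Td.
  by move=> i /cost[c [_ Hc]]; exists c.
have Dsm : small D.
  case: HD => [->|[i [im Di]]]; first exact: small0.
  by have [c [csm /Di Dc]] := cost i im; apply: small_leq Dc csm.
exists T'.
  split; last by move=> x /T'x xD; apply/Mn_small; exists D.
  have [t tns dDt] := small_add dsm Dsm.
  by exists t => //; apply: is_tree_leq dDt T'd.
by move=> w; rewrite T'c ?aT //; apply: (svalP w).
Qed.

(** On [F_nb] a member of [G_nb] acts as its tuple of functions; the value 0
    beyond the length of the tuple is also the default value of [ftuple_app]. *)
Lemma G_nb_ftuple Theta : G_nb (n := n) 0 Theta -> exists g : M,
  (forall alpha, F_nb alpha ->
     F_nb (fun w : Omega n => star3 ftuple_app g (alpha w) (sval w))) /\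
  forall alpha, F_nb alpha ->
    rapp Theta (vec1 alpha) = fun w => star3 ftuple_app g (alpha w) (sval w).
Proof.
move=> [_ [m [g [_ gm gF gE]]]]; exists g; split=> alpha aF.
  exact: F_nb_ftuple_app gm gF aF.
apply: funext => w; have [lt_m ge_m] := gE alpha aF w.
have [/lt_m//|nm] := EM (alpha w <* m).
rewrite ge_m //; apply/esym.
have H c f : is_ftuple c f -> forall i v, ~ i < c -> ftuple_app f i v = 0.
  by move=> cf i v; apply: ftuple_app_default cf.
have HsM : forall c f : M, starR2 is_ftuple c f ->
    forall i v, ~ i <* c -> star3 ftuple_app f i v = star0 0.
  by transfer_from HM H.
exact: HsM gm _ _ nm.
Qed.

Lemma rapp_F_nb Theta alpha : G_nb (n := n) 0 Theta -> F_nb alpha ->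
  F_nb (rapp Theta (vec1 alpha)).
Proof. by move=> /G_nb_ftuple[g [gF gE]] aF; rewrite gE //; apply: gF. Qed.

End Model.

(** * The Boolean algebra *)

Section BooleanAlgebra.
Variables (M : structure L_all) (HM : models_Th M) (n : M).
Implicit Types (A B C P Q : set (Omega n)).

Lemma set_codeP c A w : set_code c A -> A w <-> starR2 set_mem (sval w) c.
Proof.
move=> cA; rewrite cA; split=> [Aw|[v Av e]]; first by exists w.
suff -> : w = v by [].
by case: w v e {Av} => x Hx [y Hy] /= e; subst y; congr exist; apply: Prop_irrelevance.
Qed.

Lemma coded_comprehension (Q : M -> Prop) A :
  (exists c, forall x, starR2 set_mem x c <-> starR2 in_sample_space n x /\ Q x) ->
  (forall w, A w <-> Q (sval w)) -> coded A.
Proof.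
move=> [c cQ] AQ; exists c => x; rewrite cQ; split=> [[xn Qx]|[w /AQ Qw ->]].
  by exists (exist _ x xn) => //; apply/AQ.
by split=> //; apply: svalP w.
Qed.

Lemma coded_setC A : coded A -> coded (~` A).
Proof.
move=> [a aA]; apply: (coded_comprehension (Q := fun x => ~ starR2 set_mem x a)).
  have H (k s : nat) := comprehension k (fun x => ~ set_mem x s).
  by generalize n a; transfer_from HM H.
by move=> w; rewrite -(set_codeP w aA).
Qed.

Lemma coded_setI A B : coded A -> coded B -> coded (A `&` B).
Proof.
move=> [a aA] [b bB]; apply: (coded_comprehension
  (Q := fun x => starR2 set_mem x a /\ starR2 set_mem x b)).
  have H (k s t : nat) := comprehension k (fun x => set_mem x s /\ set_mem x t).
  by generalize n a b; transfer_from HM H.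
by move=> w; rewrite -(set_codeP w aA) -(set_codeP w bB).
Qed.

Lemma coded_setU A B : coded A -> coded B -> coded (A `|` B).
Proof.
move=> cA cB; rewrite -[A `|` B]setCK setCU; apply: coded_setC.
by apply: coded_setI; apply: coded_setC.
Qed.

Lemma coded_setD A B : coded A -> coded B -> coded (A `\` B).
Proof. by move=> cA cB; apply: coded_setI => //; apply: coded_setC. Qed.

Lemma coded_setY A B : coded A -> coded B -> coded (A `+` B).
Proof. by move=> cA cB; rewrite setY_def; apply: coded_setU; apply: coded_setD. Qed.

Lemma coded_setT : coded (setT : set (Omega n)).
Proof.
apply: (coded_comprehension (Q := fun x => x = x)); last by [].
have H (k : nat) := comprehension k (fun x => x = x).
by generalize n; transfer_from HM H.
Qed.

Lemma negligible_coded A : negligible A -> coded A.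
Proof. by move=> [c cA _]; exists c. Qed.

Lemma star_ratio_lt_add k (a b c : M) : 0 < k -> starR2 leq c (star2 addn a b) ->
  (forall k, 0 < k -> starR2 (ratio_lt k) a (star1 card_sample_space n)) ->
  (forall k, 0 < k -> starR2 (ratio_lt k) b (star1 card_sample_space n)) ->
  starR2 (ratio_lt k) c (star1 card_sample_space n).
Proof.
move=> k0 cab aN bN; have k2 : 0 < k * 2 by rewrite muln_gt0 k0.
have H c a b N := @ratio_lt_add k a b c N k0.
have HsM : forall c a b N : M, starR2 leq c (star2 addn a b) ->
  starR2 (ratio_lt (k * 2)) a N -> starR2 (ratio_lt (k * 2)) b N ->
  starR2 (ratio_lt k) c N by transfer_from HM H.
exact: HsM cab (aN _ k2) (bN _ k2).
Qed.

(** The infinitesimal sizes form an ideal because every standard [k] may be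
    replaced by [2k]. *)
Lemma negligible_cover A B C : negligible A -> negligible B -> coded C ->
  C `<=` A `|` B -> negligible C.
Proof.
move=> [a aA Na] [b bB Nb] [c cC] CAB; exists c => // k k0.
apply: star_ratio_lt_add k0 _ Na Nb.
have Hs : forall a b c : M,
    (forall x, starR2 set_mem x c -> starR2 set_mem x a \/ starR2 set_mem x b) ->
    starR2 leq (star1 set_card c) (star2 addn (star1 set_card a) (star1 set_card b)).
  by transfer_from HM set_card_cover.
apply: Hs => x /cC[w /CAB[Aw|Bw] ->]; [left|right].
  by apply/(set_codeP w aA).
by apply/(set_codeP w bB).
Qed.

Lemma negligible_subset A C : negligible A -> coded C -> C `<=` A -> negligible C.
Proof. by move=> nA cC CA; apply: (negligible_cover nA nA cC) => w /CA; left. Qed.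

Lemma negligible0 : negligible (set0 : set (Omega n)).
Proof.
have [c c0] : coded (set0 : set (Omega n)).
  by rewrite -setCT; apply/coded_setC/coded_setT.
exists c => // k k0.
have -> : star1 set_card c = star0 0.
  have c0' x : ~ starR2 set_mem x c by move=> /c0[].
  by move: c c0' {c0}; transfer_from HM set_card_empty.
have H (N : nat) := ratio_lt0 N k0.
by generalize (star1 card_sample_space n); transfer_from HM H.
Qed.

(** The operations on classes are defined through all representatives; the lemmas
    below compute them from given ones. *)
Lemma Ble_cls A B : coded A -> coded B -> Ble (cls A) (cls B) <-> negligible (A `\` B).
Proof.
move=> cA cB; split=> [[P [Q [[cP AP] [cQ BQ] PQ]]]|AB].
  have nU : negligible ((A `+` P) `|` (B `+` Q)).
    apply: (negligible_cover AP BQ) => //.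
    by apply: coded_setU; apply: negligible_coded.
  apply: (negligible_cover nU PQ); first exact: coded_setD.
  move=> w [Aw nBw]; rewrite !setY_def /=.
  by case: (EM (P w)) => Pw; case: (EM (Q w)) => Qw;
    rewrite /setU /setD /mkset /=; tauto.
exists A, B; split=> //; split=> //; rewrite setYK; exact: negligible0.
Qed.

Lemma cls_refl A : coded A -> cls A A.
Proof. by move=> cA; split=> //; rewrite setYK; apply: negligible0. Qed.

Lemma cls_eq A B : coded A -> cls A B -> cls B = cls A.
Proof.
move=> cA [cB AB]; apply/seteqP; split=> C [cC BC]; split=> //.
  apply: (negligible_cover AB BC); first exact: coded_setY.
  move=> w; rewrite !setY_def /setU /setD /mkset /=.
  by case: (EM (B w)); tauto.
apply: (negligible_cover AB BC); first exact: coded_setY.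
move=> w; rewrite !setY_def /setU /setD /mkset /=.
by case: (EM (A w)); tauto.
Qed.

Lemma cls_le_anti A B : coded A -> coded B -> Ble (cls A) (cls B) ->
  Ble (cls B) (cls A) -> cls A B.
Proof.
move=> cA cB /(Ble_cls cA cB) AB /(Ble_cls cB cA) BA; split=> //.
by apply: (negligible_cover AB BA); [exact: coded_setY|rewrite setY_def].
Qed.

Lemma Bneg_cls A : coded A -> Bneg (cls A) = cls (~` A).
Proof.
move=> cA; rewrite /Bneg; apply/seteqP; split=> [C [P [cP AP] PC]|C AC].
  rewrite -(@cls_eq (~` A) (~` P)) //; first exact: coded_setC.
  split; first exact: coded_setC.
  by apply: (negligible_subset AP); [by apply: coded_setY; apply: coded_setC|];
    move=> w; rewrite !setY_def /setU /setD /setC /mkset /=;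
    case: (EM (A w)); case: (EM (P w)); tauto.
by exists A => //; apply: cls_refl.
Qed.

Lemma Band_cls A B : coded A -> coded B -> Band (cls A) (cls B) = cls (A `&` B).
Proof.
move=> cA cB; rewrite /Band; have cAB := coded_setI cA cB.
apply/seteqP; split=> [C [P [cP AP] [Q [cQ BQ] PQC]]|C AC].
  have cPQ := coded_setI cP cQ.
  rewrite -(@cls_eq (A `&` B) (P `&` Q)) //; split=> //.
  by apply: (negligible_cover AP BQ); [exact: coded_setY|];
    move=> w; rewrite !setY_def /setU /setD /setI /mkset /=;
    case: (EM (A w)); case: (EM (B w)); case: (EM (P w)); case: (EM (Q w)); tauto.
by exists A; [exact: cls_refl|exists B => //; exact: cls_refl].
Qed.

Lemma Bor_cls A B : coded A -> coded B -> Bor (cls A) (cls B) = cls (A `|` B).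
Proof.
move=> cA cB; rewrite /Bor; have cAB := coded_setU cA cB.
apply/seteqP; split=> [C [P [cP AP] [Q [cQ BQ] PQC]]|C AC].
  have cPQ := coded_setU cP cQ.
  rewrite -(@cls_eq (A `|` B) (P `|` Q)) //; split=> //.
  by apply: (negligible_cover AP BQ); [exact: coded_setY|];
    move=> w; rewrite !setY_def /setU /setD /mkset /=;
    case: (EM (A w)); case: (EM (B w)); case: (EM (P w)); case: (EM (Q w)); tauto.
by exists A; [exact: cls_refl|exists B => //; exact: cls_refl].
Qed.

(** By antisymmetry a greatest lower bound is unique as a class, and its
    representatives are those which [Binf] collects. *)
Lemma Binf_eq S A : coded A -> is_glb S (cls A) -> Binf S = cls A.
Proof.
move=> cA SA; apply/seteqP; split=> [P [cP [lbP glbP]]|P AP]; last first.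
  by split; [case: AP|rewrite (cls_eq cA AP)].
apply: cls_le_anti => //; first by apply: glbP; [exists A|case: SA].
by case: SA => _; apply; [exists P|].
Qed.

Lemma Bsup_eq S A : coded A -> is_lub S (cls A) -> Bsup S = cls A.
Proof.
move=> cA SA; apply/seteqP; split=> [P [cP [ubP lubP]]|P AP]; last first.
  by split; [case: AP|rewrite (cls_eq cA AP)].
apply: cls_le_anti => //; last by apply: lubP; [exists A|case: SA].
by case: SA => _; apply; [exists P|].
Qed.

Lemma Ble_B1 A : coded A -> Ble (cls A) (B1 (n := n)).
Proof.
move=> cA; apply/Ble_cls => //; first exact: coded_setT.
by rewrite setDT; apply: negligible0.
Qed.

Lemma Binf_B1 S : (forall b, S b -> b = B1 (n := n)) -> Binf S = B1 (n := n).
Proof.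
move=> SB; apply: Binf_eq; first exact: coded_setT.
split=> [c /SB ->|b [A cA <-] _]; last exact: Ble_B1.
by apply: Ble_B1; apply: coded_setT.
Qed.
End BooleanAlgebra.

(** * The retraction weak pigeonhole principle *)

Section Retraction.
Variables (M : structure L_all) (HM : models_Th M) (n : M) (Hn : nonstandard n).
Variables (X Y : Omega n -> M) (XG : G_nb 0 X) (YG : G_nb 0 Y).
Implicit Types (m x : Omega n -> M).
Local Notation "x <=* y" := (starR2 leq x y) (at level 70).
Local Notation "x <* y" := (starR2 (fun a b => a < b) x y) (at level 70).

Definition m_zero m : set (Omega n) := [set w | m w = star0 0].
Definition x_short m x : set (Omega n) :=
  [set w | star1 bitlen (x w) <* star1 bitlen (m w)].
Definition image_long m x : set (Omega n) :=
  [set w | star2 subn (star1 bitlen (m w)) (star0 1) <=*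
           star1 bitlen (rapp X (vec1 x) w)].
Definition retracted x : set (Omega n) :=
  [set w | rapp Y (vec1 (rapp X (vec1 x))) w = x w].

Definition witnessed m x : set (Omega n) :=
  m_zero m `|` (x_short m x `&` (image_long m x `|` ~` retracted x)).

Lemma coded_F_nb (R : nat -> nat -> Prop) (alpha beta : Omega n -> M)
    (A : set (Omega n)) : F_nb alpha -> F_nb beta ->
  (forall w, A w <-> starR2 R (alpha w) (beta w)) -> coded A.
Proof.
move=> [S _ aS] [T _ bT] AR.
apply: (coded_comprehension
  (Q := fun v => starR2 R (star2 compute S v) (star2 compute T v))).
  have H k a b := comprehension k (fun v => R (compute a v) (compute b v)).
  suff HsM : forall k a b : M, exists c, forall v, starR2 set_mem v c <->
      starR2 in_sample_space k v /\ starR2 R (star2 compute a v) (star2 compute b v).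
    exact: HsM.
  by transfer_from HM H.
by move=> w; rewrite AR aS bT.
Qed.

Lemma coded_atoms m x : F_nb m -> F_nb x ->
  [/\ coded (m_zero m), coded (x_short m x), coded (image_long m x) &
      coded (retracted x)].
Proof.
move=> mF xF; have XF := rapp_F_nb HM Hn XG xF; have YF := rapp_F_nb HM Hn YG XF.
split.
- apply: (coded_F_nb (R := fun a b => a = 0) mF mF) => w.
  have H (a : nat) : a = 0 <-> a = 0 by [].
  by rewrite /m_zero /mkset; move: (m w); transfer_from HM H.
- apply: (coded_F_nb (R := fun a b => bitlen a < bitlen b) xF mF) => w.
  have H a b : bitlen a < bitlen b <-> bitlen a < bitlen b by [].
  by rewrite /x_short /mkset; move: (x w) (m w); transfer_from HM H.
- apply: (coded_F_nb (R := fun a b => bitlen b - 1 <= bitlen a) XF mF) => w.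
  have H a b : bitlen b - 1 <= bitlen a <-> bitlen b - 1 <= bitlen a by [].
  by rewrite /image_long /mkset; move: (rapp _ _ w) (m w); transfer_from HM H.
- apply: (coded_F_nb (R := fun a b => a = b) YF xF) => w.
  have H (a b : nat) : a = b <-> a = b by [].
  by rewrite /retracted /mkset; move: (rapp _ _ w) (x w); transfer_from HM H.
Qed.

Lemma coded_witnessed m x : F_nb m -> F_nb x -> coded (witnessed m x).
Proof.
move=> mF xF; have [c0 c1 c2 c3] := coded_atoms mF xF.
apply: coded_setU => //; apply: coded_setI => //; apply: coded_setU => //.
exact: coded_setC.
Qed.

Lemma Kval_RetractionWeakPigeon m x : F_nb m -> F_nb x ->
  Kval (RetractionWeakPigeon HM Hn) (vcons x (vcons m (vec0 _)))
    (vcons Y (vcons X (vec0 _))) = cls (witnessed m x).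
Proof.
move=> mF xF; have [c0 c1 c2 c3] := coded_atoms mF xF.
have c3' := coded_setC HM c3; have c23 := coded_setU HM c2 c3'.
rewrite /witnessed -(Bor_cls HM) -?(Band_cls HM) -?(Bor_cls HM) -?(Bneg_cls HM) //;
  last exact: coded_setI.
set e := vcons x _; set E := vcons Y _.
have ex : e (@Ordinal 2 0 isT) = x.
  by rewrite (_ : Ordinal _ = ord0) ?[e _]vcons0 //; apply: val_inj.
have em : e (@Ordinal 2 1 isT) = m.
  rewrite (_ : Ordinal _ = lift ord0 ord0) ?[e _]vconsS ?vcons0 //.
  exact: val_inj.
have EY : E (@Ordinal 2 0 isT) = Y.
  by rewrite (_ : Ordinal _ = ord0) ?[E _]vcons0 //; apply: val_inj.
have EX : E (@Ordinal 2 1 isT) = X.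
  rewrite (_ : Ordinal _ = lift ord0 ord0) ?[E _]vconsS ?vcons0 //.
  exact: val_inj.
pose tm := term2 (L_n n) 2 [:: 0; 0].
pose K : tm -> Omega n -> M := @Kterm M n 2 [:: 0; 0] e E.
have v0 w : (fun i => K (vec0 tm i) w) = vec0 M by apply: vec0E.
have v1 (t : tm) w : (fun i => K (vec1 t i) w) = vec1 (K t w).
  by rewrite /vec1 (map_vcons (fun t : tm => K t w)) v0.
have v2 (t u : tm) w : (fun i => K (vec2 t u i) w) = vec2 (K t w) (K u w).
  by rewrite /vec2 (map_vcons (fun t : tm => K t w)) v1.
have vK (t : tm) : (fun i => K (vec1 t i)) = vec1 (K t).
  by rewrite /vec1 (map_vcons (fun t : tm => K t)) (vec0E (fun _ => _)).
have KX (t : tm) : K (tX t) = rapp X (vec1 (K t)) by rewrite -EX -vK.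
have KY (t : tm) : K (tY t) = rapp Y (vec1 (K t)) by rewrite -EY -vK.
have KLen (t : tm) w : K (tLen HM t) w = star1 bitlen (K t w).
  by rewrite /star1 -v1.
have KSub (t u : tm) w : K (tSub HM t u) w = star2 subn (K t w) (K u w).
  by rewrite /star2 -v2.
have K1 w : K (tOne HM Hn) w = star0 1 by rewrite /star0 -(v0 w).
have K0 w : K (tZero HM Hn) w = star0 0 by rewrite /star0 -(v0 w).
have KXx : K (tX (txv n)) = rapp X (vec1 x) by rewrite KX -ex.
rewrite /RetractionWeakPigeon /Kval.
congr (Bor _ (Band _ (Bor _ (Bneg _)))); congr cls; apply: funext => w.
- by rewrite /m_zero /mkset -(K0 w) -em.
- rewrite /x_short /mkset.
  rewrite -[X in rint _ _ X]/(fun i =>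
    K (vec2 (tLen HM (txv n)) (tLen HM (tmv n)) i) w).
  by rewrite v2 !KLen /K /= ex em.
- rewrite /image_long /mkset.
  rewrite -[X in rint _ _ X]/(fun i => K (vec2 (tLen HM (tX (txv n)))
    (tSub HM (tLen HM (tmv n)) (tOne HM Hn)) i) w).
  rewrite v2 KSub !KLen K1 KXx /K /= em.
  suff HsM : forall a b : M, starR2 (fun a b => a >= b) a b <-> b <=* a.
    exact/propext/HsM.
  have H a b : b <= a <-> b <= a by [].
  by transfer_from HM H.
- by rewrite /retracted /mkset -KXx -KY -ex.
Qed.

Lemma star_halving_round (s gX gY T B : M) :
  (forall w, starR2 set_mem w s -> star2 compute T w <=* B) ->
  exists r, r <=* B /\ forall a,
    (forall w, starR2 set_mem w s -> starR2 set_mem w a \/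
       (~ (star2 compute T w = star0 0) /\
        star1 bitlen
          (star3 ftuple_app gX (star2 residue r (star2 compute T w)) w) <*
          star2 subn (star1 bitlen (star2 compute T w)) (star0 1) /\
        star3 ftuple_app gY
          (star3 ftuple_app gX (star2 residue r (star2 compute T w)) w) w =
          star2 residue r (star2 compute T w))) ->
    star1 set_card s <=* star2 addn (star1 set_card a) (star1 set_card a).
Proof. by move: s gX gY T B; transfer_from HM halving_round. Qed.

Lemma star_bitlen_residue (r m : M) : m <> star0 0 ->
  star1 bitlen (star2 residue r m) <* star1 bitlen m.
Proof.
have H a b : b <> 0 -> bitlen (residue a b) < bitlen b.
  by move=> /eqP; rewrite -lt0n; apply: bitlen_residue.
by move: r m; transfer_from HM H.
Qed.

(** The witness [x] is chosen for a given upper bound [P]: it succeeds on at least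
    half of the complement [s] of [P], while the upper bound confines its success
    outside [P] to a negligible set. *)
Lemma Bsup_witnessed m : F_nb m ->
  Bsup [set cls (witnessed m a) | a in F_nb (n := n)] = B1 (n := n).
Proof.
move=> mF; apply: Bsup_eq => //; first exact: coded_setT.
split=> [_ [a aF <-]|_ [P cP <-] ubP]; first exact/Ble_B1/coded_witnessed.
apply/Ble_cls => //; first exact: coded_setT.
rewrite setTD; have [s sP] := coded_setC HM cP; exists s => // k k0.
have [gX [gXF XE]] := G_nb_ftuple HM Hn XG.
have [gY [_ YE]] := G_nb_ftuple HM Hn YG.
have [T [[t _ Tt] TM] mT] := mF; have [B [BT leB]] := star_max_leaf HM T.
have BM : Mn n B by case: BT => [->|/TM//]; apply: Mn0.
have [|r [rB halve]] := star_halving_round (s := s) gX gY (T := T) (B := B).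
  by move=> w /sP[v _ ->]; apply/leB/(star_compute_leaf HM _ Tt).
pose x w := star2 residue r (m w).
have xF : F_nb x by apply: F_nb_residue => //; apply: Mn_leq rB BM.
have cW := coded_witnessed mF xF.
have /(Ble_cls HM cW cP)[a aA Na] : Ble (cls (witnessed m x)) (cls P).
  by apply: ubP; exists x.
apply: (star_ratio_lt_add HM k0 _ Na Na); apply: halve => _ /sP[w nPw ->].
rewrite -mT; have [Ww|nW] := EM (witnessed m x w).
  by left; apply/(set_codeP w aA).
right; have m0 : m w <> star0 0 by move=> m0; apply: nW; left.
have sx : x_short m x w by apply: star_bitlen_residue.
have [/= nlong /contrapT ret] : ~ image_long m x w /\ ~ ~ retracted x w.
  by split=> H; apply: nW; right; split=> //; [left|right].
move: ret nlong; rewrite /retracted /image_long /mkset YE XE //; last exact: gXF.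
move=> ret nlong; split=> //; split=> //.
by have [] := star_leq_or_gt HM (star1 bitlen (star3 ftuple_app gX (x w) (sval w)))
  (star2 subn (star1 bitlen (m w)) (star0 1)).
Qed.

End Retraction.

Theorem theorem6p9 (M : structure L_all) (HM : models_Th M)
    (Hsat : aleph1_saturated M) (n : M) (Hn : nonstandard n)
    (Hpow : power_of_two n) :
  Ksentence (AllSet2 (j := 0) (AllSet2 (j := 0) (All2 (Ex2
    (RetractionWeakPigeon HM Hn))))) = B1 (n := n).
Proof.
apply: (Binf_B1 HM) => _ [X XG <-]; apply: (Binf_B1 HM) => _ [Y YG <-].
apply: (Binf_B1 HM) => _ [m mF <-].
rewrite -[LHS]/(Bsup _) -(Bsup_witnessed HM Hn XG YG mF); congr Bsup.
have KE x (xF : F_nb x) := Kval_RetractionWeakPigeon HM Hn XG YG mF xF.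
by apply/seteqP; split=> _ [x xF <-]; exists x => //; [symmetry|]; apply: KE.
Qed.
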